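(* Let $k$ be a field, let $p,m\ge 1$, $n\ge 0$ be integers and let $0\le q\le np$. The coordinate ring $A=k[\mathcal{C}^q_{p,m}]/\ker\varphi\cong\mathrm{image}(\varphi)$ of the quantum Grassmannian $K^q_{p,m}$ is an algebra with straightening law on the distributive lattice $\mathcal{C}^q_{p,m}$. Moreover, $A$ has a presentation by a non-commutative Gröbner basis consisting of quadratic elements: the two-sided ideal presenting $A$ as a quotient of the free associative $k$-algebra on $\mathcal{C}^q_{p,m}$ has (for some monomial order on words) a Gröbner basis consisting of quadratic elements. In particular, $A$ is a Koszul algebra.
   Context: $\binom{[m+p]}{p}$ is the set of sequences $\alpha=(\alpha_1<\dots<\alpha_p)$ of integers in $\{1,\dots,m+p\}$. $\mathcal{C}^q_{p,m}$ is the set of formal symbols $\alpha^{(a)}$ with $\alpha\in\binom{[m+p]}{p}$, $0\le a\le q$, partially ordered by $\alpha^{(a)}\le\beta^{(b)}$ iff $a\le b$ and $\alpha_i\le\beta_{b-a+i}$ for $i=1,\dots,p-b+a$; it is a distributive lattice. $k[\mathcal{C}^q_{p,m}]$ is the polynomial ring on these symbols, each of degree 1. $k[X]$ is the polynomial ring over $k$ in the variables $x_{i,j}^{(l)}$, $1\le i\le p$, $1\le j\le m+p$, $0\le l\le n$. Let $\mathcal{M}_q(t)$ be the $p\times(m+p)$-matrix whose $(i,j)$ entry is $\sum_l x_{i,j}^{(l)}t^l$, the sum being over those $l\in\{0,\dots,n\}$ with $pl+i\le p+q$ (so, if $q=ps+r$ with $0\le r<p$, rows $1,\dots,r$ have degree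 $s+1$ and the other rows have degree $s$, and maximal minors have degree $q$ in $t$). The $k$-algebra homomorphism $\varphi:k[\mathcal{C}^q_{p,m}]\to k[X]$ sends $\alpha^{(a)}$ to the coefficient of $t^a$ in the maximal minor of $\mathcal{M}_q(t)$ with columns $\alpha_1,\dots,\alpha_p$. The quantum Grassmannian $K^q_{p,m}$ (the closure, in the Plücker embedding, of the space of degree $q$ maps $\mathbb{P}^1\to \mathrm{Grass}_p k^{m+p}$) is the projective variety with homogeneous prime ideal $\ker\varphi$. A graded $k$-algebra $A$ generated by a finite poset $H$ of degree-1 elements is an algebra with straightening law on $H$ if (i) the standard monomials $h_1h_2\cdots h_j$ with $h_1\le h_2\le\dots\le h_j$ in $H$ form a $k$-basis of $A$, and (ii) for incomparable $\gamma,\delta\in H$, every standard monomial occurring with nonzero coefficient in the expansion of $\gamma\delta$ contains a factor $\zeta\in H$ with $\zeta<\gamma$ and $\zeta<\delta$. *)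

(* Defs.v *)
From HB Require Import structures.
From mathcomp Require Import all_boot all_order all_algebra.
From mathcomp Require Import generic_quotient ring_quotient zify.
From mathcomp Require Import finmap monalg.

Set Implicit Arguments.
Unset Strict Implicit.
Unset Printing Implicit Defensive.

Import Order.TTheory GRing.Theory.

(* The column set {1, ..., N} is represented by 'I_N, i.e. shifted by one.    *)
Definition increasing (p N : nat) : pred {ffun 'I_p -> 'I_N} :=
  fun al => [forall i : 'I_p, forall j : 'I_p, (i < j)%N ==> (al i < al j)%N].

Definition incseq (p N : nat) := {al : {ffun 'I_p -> 'I_N} | increasing al}.

HB.instance Definition _ p N := Finite.on (incseq p N).

(* QSymb al a is the formal symbol al^(a).                                    *)
Record qsymb (p m q : nat) := QSymb {
  qseq : incseq p (m + p);
  qdeg : 'I_q.+1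
}.

Definition qsymb_pair p m q (x : qsymb p m q) := (qseq x, qdeg x).
Definition pair_qsymb p m q (y : incseq p (m + p) * 'I_q.+1) :=
  QSymb y.1 y.2.
Lemma qsymb_pairK p m q : cancel (@qsymb_pair p m q) (@pair_qsymb p m q).
Proof. by case. Qed.

HB.instance Definition _ p m q :=
  Finite.copy (qsymb p m q) (can_type (@qsymb_pairK p m q)).

Definition qcol p m q (x : qsymb p m q) (i : 'I_p) : 'I_(m + p) :=
  val (qseq x) i.

Section QuantumLattice.
Variables p m q : nat.
Local Notation C := (qsymb p m q).
Implicit Types x y z : C.

Definition qsymb_le x y : bool :=
  (qdeg x <= qdeg y)%N &&
  [forall i : 'I_p, forall j : 'I_p,
    (j == qdeg y - qdeg x + i :> nat)%N ==> (qcol x i <= qcol y j)%N].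

(* qext x lists the entries of x = al^(a), shifted by a, padded with 0 on the *)
(* left and with m + p + 1 on the right; it embeds C into a power of nat.     *)
Definition qext x (t : nat) : nat :=
  if (t + qdeg x <= q)%N then 0
  else oapp (fun i => (qcol x i).+1) (m + p).+1 (insub (t + qdeg x - q.+1)%N).

Definition qadm (a : nat) (f : nat -> nat) := forall t,
  [/\ (t + a <= q)%N -> f t = 0%N,
      (q < t + a)%N -> (0 < f t)%N,
      (q + p < t + a)%N -> f t = (m + p).+1,
      (t + a <= q + p)%N -> (f t <= m + p)%N
    & (q < t + a)%N -> (t + a < q + p)%N -> (f t < f t.+1)%N].

Lemma qext_in x (i : 'I_p) t : (t + qdeg x = i + q.+1)%N ->
  qext x t = (qcol x i).+1.
Proof.
move=> e; rewrite /qext e ifF; last by apply/negbTE; lia.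
rewrite addnK; case: insubP => [j _ jE|]; last by rewrite ltn_ord.
by congr (nat_of_ord (qcol x _)).+1; apply: val_inj.
Qed.

Lemma qcol_lt x (i j : 'I_p) : (i < j)%N -> (qcol x i < qcol x j)%N.
Proof. by move/(implyP (forallP (forallP (valP (qseq x)) i) j)). Qed.

Lemma qext_adm x : qadm (qdeg x) (qext x).
Proof.
move=> t; have out : (q + p < t + qdeg x)%N -> qext x t = (m + p).+1.
  move=> h; rewrite /qext ifF; last by apply/negbTE; lia.
  by rewrite insubF //; apply/negbTE; lia.
have inn t' : (q < t' + qdeg x)%N -> (t' + qdeg x <= q + p)%N ->
    exists2 i : 'I_p, (t' + qdeg x = i + q.+1)%N & qext x t' = (qcol x i).+1.
  move=> h1 h2; have hi : (t' + qdeg x - q.+1 < p)%N by lia.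
  by exists (Ordinal hi); [|apply: qext_in]; rewrite /=; lia.
have zero : (t + qdeg x <= q)%N -> qext x t = 0%N by move=> h; rewrite /qext h.
split=> // [h|h|h1 h2].
- case: (leqP (t + qdeg x) (q + p)) => [h'|/out-> //].
  by have [i _ ->] := inn t h h'.
- case: (leqP (t + qdeg x) q) => [/zero-> //|h'].
  by have [i _ ->] := inn t h' h.
- have [||i ei ->] := inn t; try lia.
  have [||j ej ->] := inn t.+1; try lia.
  by rewrite ltnS qcol_lt //; lia.
Qed.

Lemma qext_inj x y : qext x =1 qext y -> x = y.
Proof.
move=> e; have hxy : qdeg x = qdeg y.
  have key u v : qext u =1 qext v -> (qdeg v <= qdeg u)%N.
    move=> uv; rewrite leqNgt; apply/negP => lt_uv; have hu := ltn_ord (qdeg u).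
    have [u1 _ _ _ _] := qext_adm u (q - qdeg u).
    have [_ v2 _ _ _] := qext_adm v (q - qdeg u).
    have h1 : (q - qdeg u + qdeg u <= q)%N by lia.
    have h2 : (q < q - qdeg u + qdeg v)%N by lia.
    by have := v2 h2; rewrite -uv u1.
  by apply: val_inj; apply/eqP; rewrite eqn_leq !key // => t; rewrite e.
case: x y e hxy => [al a] [be b] e /= hxy; subst b; congr QSymb.
apply/val_inj/ffunP => i; apply: val_inj => /=.
have hi : (i + q.+1 - a + a = i + q.+1)%N by have := ltn_ord a; lia.
have := e (i + q.+1 - a)%N; rewrite (@qext_in (QSymb al a) i) //.
by rewrite (@qext_in (QSymb be a) i) // => -[].
Qed.

Lemma qsymb_leP x y :
  reflect (forall t, (qext x t <= qext y t)%N) (qsymb_le x y).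
Proof.
apply: (iffP andP) => [[hab /forallP h] t|h].
  have [x1 x2 x3 x4 _] := qext_adm x t; have [y1 y2 y3 y4 _] := qext_adm y t.
  case: (leqP (t + qdeg x) q) => [/x1-> //|hx].
  case: (leqP (t + qdeg y) (q + p)) => [hy|]; last first.
    move=> /y3 ->; case: (leqP (t + qdeg x) (q + p)) => [/x4|/x3 -> //].
    by move/leqW.
  have hi : (t + qdeg x - q.+1 < p)%N by lia.
  have hj : (t + qdeg y - q.+1 < p)%N by lia.
  rewrite (@qext_in x (Ordinal hi)) /=; last by lia.
  rewrite (@qext_in y (Ordinal hj)) /=; last by lia.
  have /forallP/(_ (Ordinal hj))/implyP := h (Ordinal hi); rewrite ltnS.
  by apply; apply/eqP => /=; lia.
have hab : (qdeg x <= qdeg y)%N.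
  rewrite leqNgt; apply/negP => lt_yx; have hy := ltn_ord (qdeg y).
  have [y1 _ _ _ _] := qext_adm y (q - qdeg y).
  have [_ x2 _ _ _] := qext_adm x (q - qdeg y).
  have := h (q - qdeg y)%N; rewrite y1; last by lia.
  have h2 : (q < q - qdeg y + qdeg x)%N by lia.
  by rewrite leqn0 => /eqP x0; have := x2 h2; rewrite x0.
split=> //; apply/forallP => i; apply/forallP => j; apply/implyP => /eqP e.
have := h (i + q.+1 - qdeg x)%N; have hx := ltn_ord (qdeg x).
have hy := ltn_ord (qdeg y).
rewrite (@qext_in x i); last by lia.
by rewrite (@qext_in y j) ?ltnS //; lia.
Qed.

Definition qbuild x (a : 'I_q.+1) (f : nat -> nat) : C :=
  QSymb (insubd (qseq x)
           [ffun i : 'I_p => insubd (qcol x i) (f (i + q.+1 - a)%N).-1]) a.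

Lemma qbuildK x (a : 'I_q.+1) f : qadm a f -> qext (qbuild x a f) =1 f.
Proof.
move=> fP t; have ha := ltn_ord a.
have [b1 b2 b3 b4 _] := qext_adm (qbuild x a f) t; rewrite /= in b1 b2 b3 b4.
have [f1 f2 f3 f4 _] := fP t.
case: (leqP (t + a) q) => [h|h1]; first by rewrite b1 ?f1.
case: (ltnP (q + p) (t + a)) => [h|h2]; first by rewrite b3 ?f3.
have hi : (t + a - q.+1 < p)%N by lia.
rewrite (@qext_in _ (Ordinal hi)) /=; last by lia.
pose g := [ffun i : 'I_p => insubd (qcol x i) (f (i + q.+1 - a)%N).-1].
have gE i : (g i).+1 = f (i + q.+1 - a)%N.
  have hip := ltn_ord i; have [_ k2 _ k4 _] := fP (i + q.+1 - a)%N.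
  by rewrite ffunE val_insubd ifT; lia.
have gP : increasing g.
  apply/forallP => i; apply/forallP => j; apply/implyP => ij.
  rewrite -ltnS !gE; have hj := ltn_ord j.
  have {hj} : (j < p)%N by []; elim: {j}(j : nat) ij => // j IH ij hj.
  have [_ _ _ _ k] := fP (j + q.+1 - a)%N.
  have k' : (f (j + q.+1 - a) < f (j.+1 + q.+1 - a))%N.
    by rewrite (_ : j.+1 + q.+1 - a = (j + q.+1 - a).+1)%N; [apply: k|]; lia.
  move: ij; rewrite ltnS leq_eqVlt => /orP[/eqP ->//|ij].
  by apply: ltn_trans k'; apply: IH => //; lia.
rewrite /qcol /= val_insubd -/g gP gE /=; congr f; lia.
Qed.

Definition qmeet x y :=
  qbuild x (if (qdeg x <= qdeg y)%N then qdeg x else qdeg y)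
    (fun t => minn (qext x t) (qext y t)).
Definition qjoin x y :=
  qbuild x (if (qdeg x <= qdeg y)%N then qdeg y else qdeg x)
    (fun t => maxn (qext x t) (qext y t)).

Lemma qext_cases x t :
  ((t + qdeg x <= q)%N /\ qext x t = 0%N) \/
  ((q < t + qdeg x <= q + p)%N /\ (0 < qext x t <= m + p)%N) \/
  ((q + p < t + qdeg x)%N /\ qext x t = (m + p).+1).
Proof.
have [x1 x2 x3 x4 _] := qext_adm x t.
case: (leqP (t + qdeg x) q) => [h|h]; first by left; rewrite x1.
case: (leqP (t + qdeg x) (q + p)) => h'; last by right; right; rewrite x3.
by right; left; rewrite x2 ?x4.
Qed.

Lemma qext_lt x t : (t + qdeg x <= q)%N \/ (q + p <= t + qdeg x)%N \/
  (qext x t < qext x t.+1)%N.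
Proof.
have [_ _ _ _ x5] := qext_adm x t.
case: (leqP (t + qdeg x) q) => [h|h]; first by left.
case: (leqP (q + p) (t + qdeg x)) => h'; first by right; left.
by right; right; apply: x5.
Qed.

Lemma qext_meet x y t : qext (qmeet x y) t = minn (qext x t) (qext y t).
Proof.
rewrite qbuildK // => {}t.
have := qext_cases x t; have := qext_cases y t.
have := qext_cases x t.+1; have := qext_cases y t.+1.
have := qext_lt x t; have := qext_lt y t.
by case: (leqP (qdeg x) (qdeg y)) => hxy ? ? ? ? ? ?; split=> /=; lia.
Qed.

Lemma qext_join x y t : qext (qjoin x y) t = maxn (qext x t) (qext y t).
Proof.
rewrite qbuildK // => {}t.
have := qext_cases x t; have := qext_cases y t.
have := qext_cases x t.+1; have := qext_cases y t.+1.
have := qext_lt x t; have := qext_lt y t.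
by case: (leqP (qdeg x) (qdeg y)) => hxy ? ? ? ? ? ?; split=> /=; lia.
Qed.

Lemma qsymb_le_refl : reflexive qsymb_le.
Proof. by move=> x; apply/qsymb_leP. Qed.

Lemma qsymb_le_anti : antisymmetric qsymb_le.
Proof.
move=> x y /andP[/qsymb_leP h1 /qsymb_leP h2]; apply: qext_inj => t.
by apply/eqP; rewrite eqn_leq h1 h2.
Qed.

Lemma qsymb_le_trans : transitive qsymb_le.
Proof.
move=> y x z /qsymb_leP h1 /qsymb_leP h2; apply/qsymb_leP => t.
exact: leq_trans (h1 t) (h2 t).
Qed.

HB.instance Definition _ := Order.Le_isPOrder.Build
  (Order.Disp tt tt) C qsymb_le_refl qsymb_le_anti qsymb_le_trans.

Let qmeetC : commutative qmeet.
Proof. by move=> x y; apply: qext_inj => t; rewrite !qext_meet minnC. Qed.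
Let qjoinC : commutative qjoin.
Proof. by move=> x y; apply: qext_inj => t; rewrite !qext_join maxnC. Qed.
Let qmeetA : associative qmeet.
Proof. by move=> x y z; apply: qext_inj => t; rewrite !qext_meet minnA. Qed.
Let qjoinA : associative qjoin.
Proof. by move=> x y z; apply: qext_inj => t; rewrite !qext_join maxnA. Qed.
Let qjoinKI y x : qmeet x (qjoin x y) = x.
Proof. by apply: qext_inj => t; rewrite qext_meet qext_join; apply/minn_idPl/leq_maxl. Qed.
Let qmeetKU y x : qjoin x (qmeet x y) = x.
Proof. by apply: qext_inj => t; rewrite qext_join qext_meet; apply/maxn_idPl/geq_minl. Qed.
Let qleEmeet x y : (x <= y)%O = (qmeet x y == x).
Proof.
apply/qsymb_leP/eqP => [h|h t].
  by apply: qext_inj => t; rewrite qext_meet; apply/minn_idPl.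
by rewrite -h qext_meet geq_minr.
Qed.
Let qmeetUl : left_distributive qmeet qjoin.
Proof.
by move=> x y z; apply: qext_inj => t; rewrite !(qext_meet, qext_join) minn_maxl.
Qed.

HB.instance Definition _ := Order.POrder_Meet_isDistrLattice.Build
  (Order.Disp tt tt) C
  qmeetC qjoinC qmeetA qjoinA qjoinKI qmeetKU qleEmeet qmeetUl.

End QuantumLattice.

Local Open Scope ring_scope.
Local Open Scope quotient_scope.

Notation "{ 'polyring' k [ I ] }" := {malg k[{cmonom I}]}
  (at level 0, k, I at level 2, format "{ 'polyring'  k [ I ] }") : type_scope.
Notation "{ 'freealg' k [ I ] }" := {malg k[{fmonom I}]}
  (at level 0, k, I at level 2, format "{ 'freealg'  k [ I ] }") : type_scope.

Section CommutativeEvaluation.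
Variables (k : fieldType) (I : choiceType) (T : comAlgType k) (v : I -> T).

Definition cmonom_eval (w : {cmonom I}) : T :=
  \prod_(i <- finsupp w) v i ^+ w i.

Lemma cmonom_evalEw (w : {cmonom I}) (d : {fset I}) : (finsupp w `<=` d)%fset ->
  cmonom_eval w = \prod_(i <- d) v i ^+ w i.
Proof.
move=> le; rewrite /cmonom_eval; apply: (big_fset_incl _ le) => i _.
by rewrite -cmE_eq0 => /eqP->; rewrite expr0.
Qed.

Lemma cmonom_eval_is_multiplicative : mmorphism cmonom_eval.
Proof.
split=> [w1 w2|]; last by rewrite /cmonom_eval mdom1 big_seq_fset0.
rewrite (cmonom_evalEw (fsubsetUl (finsupp w1) (finsupp w2))).
rewrite (cmonom_evalEw (fsubsetUr (finsupp w1) (finsupp w2))).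
rewrite /cmonom_eval mdomD -big_split /=.
by apply: eq_bigr => i _; rewrite cmM exprD.
Qed.

HB.instance Definition _ :=
  isMultiplicative.Build {cmonom I} T cmonom_eval cmonom_eval_is_multiplicative.

Definition poly_eval : {polyring k[I]} -> T := mmap (in_alg T) cmonom_eval.

HB.instance Definition _ := GRing.RMorphism.on poly_eval.

Lemma poly_eval_is_scalable : scalable poly_eval.
Proof. by move=> c g; rewrite /poly_eval mmapZ /= mulr_algl. Qed.

HB.instance Definition _ :=
  GRing.isScalable.Build k {polyring k[I]} T *:%R poly_eval poly_eval_is_scalable.
End CommutativeEvaluation.

(* The quotient of a commutative k-algebra by the kernel of a k-algebra       *)
(* homomorphism f.                                                            *)
Section KernelQuotient.
Variables (k : fieldType) (S T : comAlgType k) (f : {lrmorphism S -> T}).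

Definition kernel : {pred S} := fun x => f x == 0.

Lemma kernel_idealr : idealr_closed kernel.
Proof.
split; rewrite ?unfold_in /= ?rmorph0 ?rmorph1 ?oner_eq0 //.
move=> a u v; rewrite !unfold_in /= => /eqP fu /eqP fv.
by rewrite rmorphD rmorphM /= fu fv mulr0 addr0.
Qed.

HB.instance Definition _ := isIdealr.Build S kernel kernel_idealr.

Definition kerquot := {ideal_quot kernel}.

HB.instance Definition _ := GRing.ComNzRing.on kerquot.

Definition kerpi (x : S) : kerquot := \pi_{ideal_quot kernel} x.

Lemma kerpi_eq x y : (kerpi x == kerpi y) = (f x == f y).
Proof. by rewrite /kerpi -Quotient.idealrBE unfold_in /= rmorphB subr_eq0. Qed.

Lemma kerpi_is_zmod_morphism : zmod_morphism kerpi.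
Proof. exact: rmorphB. Qed.
Lemma kerpi_is_monoid_morphism : monoid_morphism kerpi.
Proof. by split=> [|x y]; [exact: rmorph1 | exact: rmorphM]. Qed.

HB.instance Definition _ :=
  GRing.isZmodMorphism.Build S kerquot kerpi kerpi_is_zmod_morphism.
HB.instance Definition _ :=
  GRing.isMonoidMorphism.Build S kerquot kerpi kerpi_is_monoid_morphism.

Lemma kerpiK (x : kerquot) : kerpi (repr x) = x.
Proof. exact: reprK. Qed.

Definition kerquot_scale (a : k) (x : kerquot) : kerquot := kerpi (a *: repr x).

Lemma kerpi_scale a x : kerpi (a *: x) = kerquot_scale a (kerpi x).
Proof.
apply/eqP; rewrite /kerquot_scale kerpi_eq !linearZ /=.
by have /eqP -> : f x == f (repr (kerpi x)) by rewrite -kerpi_eq kerpiK.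
Qed.

Let scaleA a b x : kerquot_scale a (kerquot_scale b x) = kerquot_scale (a * b) x.
Proof. by rewrite -[x]kerpiK -!kerpi_scale scalerA. Qed.
Let scale1 : left_id 1 kerquot_scale.
Proof. by move=> x; rewrite -[x]kerpiK -kerpi_scale scale1r. Qed.
Let scaleDr : right_distributive kerquot_scale +%R.
Proof.
move=> a x y; rewrite -[x]kerpiK -[y]kerpiK -!kerpi_scale -!rmorphD /=.
by rewrite -kerpi_scale scalerDr.
Qed.
Let scaleDl x : {morph kerquot_scale^~ x : a b / a + b}.
Proof. by move=> a b; rewrite -[x]kerpiK -!kerpi_scale -rmorphD scalerDl. Qed.

HB.instance Definition _ := GRing.Zmodule_isLmodule.Build k kerquot
  scaleA scale1 scaleDr scaleDl.

Let scaleAl (a : k) (x y : kerquot) : a *: (x * y) = a *: x * y.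
Proof.
rewrite -[x]kerpiK -[y]kerpiK /GRing.scale /= -!kerpi_scale -!rmorphM /=.
by rewrite -kerpi_scale scalerAl.
Qed.

HB.instance Definition _ := GRing.Lmodule_isLalgebra.Build k kerquot scaleAl.
HB.instance Definition _ := GRing.Lalgebra_isComAlgebra.Build k kerquot.

HB.instance Definition _ :=
  GRing.isScalable.Build k S kerquot *:%R kerpi kerpi_scale.
End KernelQuotient.

Section FreeEvaluation.
Variables (k : fieldType) (A : algType k) (H : choiceType) (h : H -> A).

Definition word_eval (w : {fmonom H}) : A := \prod_(c <- w) h c.

Lemma word_eval_is_multiplicative : mmorphism word_eval.
Proof.
split=> [w1 w2|]; rewrite /word_eval; first by rewrite fmM big_cat.
by rewrite fm1 big_nil.
Qed.

HB.instance Definition _ :=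
  isMultiplicative.Build {fmonom H} A word_eval word_eval_is_multiplicative.

Definition free_eval : {freealg k[H]} -> A := mmap (in_alg A) word_eval.

HB.instance Definition _ := GRing.Additive.on free_eval.

Lemma free_eval_is_monoid_morphism : monoid_morphism free_eval.
Proof.
have comm (g : {freealg k[H]}) w w' : GRing.comm (in_alg A g@_w) (word_eval w').
  by rewrite /GRing.comm /= mulr_algl mulr_algr.
by have [fM f1] := commr_mmap_is_multiplicative comm; split.
Qed.

Lemma free_eval_is_scalable : scalable free_eval.
Proof. by move=> c g; rewrite /free_eval mmapZ /= mulr_algl. Qed.

HB.instance Definition _ := GRing.isMonoidMorphism.Build {freealg k[H]} A
  free_eval free_eval_is_monoid_morphism.
HB.instance Definition _ := GRing.isScalable.Build k {freealg k[H]} A *:%R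
  free_eval free_eval_is_scalable.
End FreeEvaluation.

(* A family gr of subsets of A makes A a connected graded k-algebra: A is the *)
(* direct sum of the gr d, and gr 0 = k.                                      *)
Record graded_algebra (k : fieldType) (A : algType k) (gr : nat -> A -> Prop) :
    Prop := GradedAlgebra {
  gr0P : forall x, gr 0%N x <-> exists c : k, x = c%:A;
  gr_zero : forall d, gr d 0;
  gr_lin : forall d (c : k) x y, gr d x -> gr d y -> gr d (c *: x + y);
  gr_mul : forall d e x y, gr d x -> gr e y -> gr (d + e)%N (x * y);
  gr_span : forall x, exists N (f : nat -> A),
    (forall d, gr d (f d)) /\ x = \sum_(d < N) f d;
  gr_direct : forall N (f : nat -> A), (forall d, gr d (f d)) ->
    \sum_(d < N) f d = 0 -> forall d, (d < N)%N -> f d = 0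
}.

(* Standard monomials are indexed by the words c_1 <= ... <= c_j in H; a      *)
(* k-linear combination of them is an element of the free algebra on H all of *)
(* whose words are nondecreasing.                                             *)
Definition standard (k : fieldType) d (H : finPOrderType d)
    (f : {freealg k[H]}) : Prop :=
  forall w, w \in msupp f -> sorted <=%O (w : seq H).

Record algebra_with_straightening_law (k : fieldType) (A : comAlgType k)
    (gr : nat -> A -> Prop) d (H : finPOrderType d) (h : H -> A) : Prop := ASL {
  asl_graded : graded_algebra gr;
  asl_inj : injective h;
  asl_deg1 : forall c, gr 1%N (h c);
  asl_generated : forall x, exists f : {freealg k[H]}, free_eval h f = x;
  asl_basis : forall x, exists! f : {freealg k[H]},
    standard f /\ free_eval h f = x;
  asl_straightening : forall (c e : H) (f : {freealg k[H]}), (c >< e)%O ->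
    standard f -> free_eval h f = h c * h e ->
    forall w, w \in msupp f -> exists2 z, z \in (w : seq H) & (z < c)%O /\ (z < e)%O
}.

(* Monomial orders on words: multiplicative total well-orders.                *)
Record word_order (I : choiceType) (le : rel {fmonom I}) : Prop := WordOrder {
  wo_total : total le;
  wo_anti : antisymmetric le;
  wo_trans : transitive le;
  wo_wf : well_founded (fun u v => (u != v) && le u v);
  wo_mul : forall u v x y, le u v -> le (mmul (mmul x u) y) (mmul (mmul x v) y)
}.

Section GroebnerBasis.
Variables (k : fieldType) (I : choiceType).
Implicit Types (le : rel {fmonom I}) (f g : {freealg k[I]}).

Definition lead_word le f (w : {fmonom I}) : Prop :=
  w \in msupp f /\ forall u, u \in msupp f -> le u w.

Definition groebner_basis le (G J : {freealg k[I]} -> Prop) : Prop :=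
  (forall g, G g -> J g) /\
  forall f w, J f -> lead_word le f w ->
    exists g u x y, [/\ G g, lead_word le g u & w = mmul (mmul x u) y].

Definition quadratic f : Prop := forall w, w \in msupp f -> fdeg w = 2%N.
End GroebnerBasis.

Definition quadratic_groebner_presentation (k : fieldType) (A : algType k)
    (H : choiceType) (h : H -> A) : Prop :=
  (forall x, exists f : {freealg k[H]}, free_eval h f = x) /\
  exists (le : rel {fmonom H}) (G : {freealg k[H]} -> Prop),
    [/\ word_order le, forall g, G g -> quadratic g
      & groebner_basis le G (fun f => free_eval h f = 0)].

Definition augmentation_ideal (k : fieldType) (A : algType k)
    (gr : nat -> A -> Prop) (x : A) : Prop :=
  exists N (f : nat -> A), (forall d, gr d.+1 (f d)) /\ x = \sum_(d < N) f d.

(* A is Koszul when k = A / A_+ has a linear free resolution                  *)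
(*   ... -> A(-2)^(b 2) -> A(-1)^(b 1) -> A -> k -> 0                         *)
(* by left modules of row vectors: v |-> v *m D i is the map from the i.+1-st *)
(* to the i-th free module, and its matrix has entries of degree one.         *)
Definition koszul (k : fieldType) (A : algType k) (gr : nat -> A -> Prop) :
    Prop :=
  graded_algebra gr /\
  exists (b : nat -> nat) (D : forall i, 'M[A]_(b i.+1, b i)),
    [/\ b 0%N = 1%N,
        forall i r c, gr 1%N (D i r c),
        forall v : 'rV[A]_(b 0%N), (forall j, augmentation_ideal gr (v 0 j)) <->
          exists u, v = u *m D 0%N
      & forall i (v : 'rV[A]_(b i.+1)), v *m D i = 0 <->
          exists u, v = u *m D i.+1].

Section QuantumGrassmannian.
Variables (k : fieldType) (p m n q : nat).

(* (i, j, l) stands for the variable x_(i+1, j+1)^(l).                        *)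
Definition xindex := ('I_p * 'I_(m + p) * 'I_n.+1)%type.
HB.instance Definition _ := Finite.on xindex.

Definition xvar (i : 'I_p) (j : 'I_(m + p)) (l : 'I_n.+1) :
  {polyring k[xindex]} := << ucm ((i, j, l) : xindex) >>.

(* With i counted from 0, the condition p l + i <= p + q becomes strict.      *)
Definition Mq : 'M[{poly {polyring k[xindex]}}]_(p, m + p) :=
  \matrix_(i, j) \sum_(l < n.+1 | (p * l + i < p + q)%N)
    (xvar i j l)%:P * 'X^l.

Definition qminor (al : incseq p (m + p)) : {poly {polyring k[xindex]}} :=
  \det (colsub (val al) Mq).

Definition qplucker (x : qsymb p m q) : {polyring k[xindex]} :=
  (qminor (qseq x))`_(qdeg x).

Definition qphi : {polyring k[qsymb p m q]} -> {polyring k[xindex]} :=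
  poly_eval qplucker.
HB.instance Definition _ := GRing.LRMorphism.on qphi.

Definition qring := kerquot qphi.
HB.instance Definition _ := GRing.ComAlgebra.on qring.

Definition qproj : {polyring k[qsymb p m q]} -> qring := kerpi qphi.
HB.instance Definition _ := GRing.LRMorphism.on qproj.

Definition qgen (x : qsymb p m q) : qring := qproj << ucm x >>.

Definition qgrading (d : nat) (y : qring) : Prop :=
  exists2 f, (forall w, w \in msupp f -> mdeg w = d) & qproj f = y.
End QuantumGrassmannian.

Arguments qgen : clear implicits.
Arguments qphi : clear implicits.
Arguments qproj : clear implicits.
Arguments qgrading : clear implicits.

(* Main.v *)
Require Import Defs.
From Stdlib Require Import IndefiniteDescription.
From HB Require Import structures.
From mathcomp Require Import all_boot all_order all_fingroup all_algebra.
From mathcomp Require Import generic_quotient finmap monalg zify.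

Set Implicit Arguments.
Unset Strict Implicit.
Unset Printing Implicit Defensive.

Import Order.TTheory GRing.Theory.
Local Open Scope ring_scope.

(** The homomorphism [qphi] sends [al^(a)] to a sum of monomials among which one is
    distinguished: number the variable x_(i,j)^(l) by [p * l + i], counting from
    zero; the distinguished monomial uses the numbers from [a] to [a + p - 1], with
    the columns of [al] in decreasing order. For a suitable weight it is the
    strictly lightest monomial ([qplucker_leads]). Reading the columns along the
    numbers embeds the poset into a power of the natural numbers, where meet and
    join are computed coordinatewise, so a standard monomial is determined by its
    lightest monomial ([word_lead_inj]): standard monomials are linearly
    independent ([standard_independent]).

    They span because of quadratic relations. Let M(t) be the matrix [Mq], and let
    al^(a), be^(b) be incomparable with a <= b, so that al_i > be_(b-a+i) for some
    i. Antisymmetrising products of minors of M(u) and M(v) over the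
    p + (b - a + 1) columns be_1 < ... < be_(b-a+i) < al_i < ... < al_p gives a
    determinant divisible by (v - u)^(b-a+1), because M(v) - M(u) is divisible by
    v - u. A multiple of this power is determined, in each total degree, by its
    coefficients outside any window of b - a + 1 consecutive places, and the window
    from a to b leaves only products with a factor of degree less than a. Inside
    the coefficient at (a, b) all products but the original one have a first factor
    with smaller columns ([plucker_exchange]). Induction on a rank gives standard
    expansions ([plucker_spanned]).

    That the first letter z of each word in the expansion of x * y lies below x and
    y follows by specialisation to a Schubert variety: when the variables that are
    too small for z are set to zero, [qplucker x] vanishes unless z <= x
    ([qplucker_vanishes]), while the words with letters above z stay independent.
    This gives the straightening law ([qplucker_straightens], [quantum_asl]).

    The other assertions hold for every algebra with straightening law. The
    straightening relations and the commutators form a Groebner basis for the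
    degree-lexicographic order of a linear extension of the poset
    ([asl_groebner]). The ideals generated by down-sets form a Koszul filtration
    ([letter_ideal_colon]): starting from the column of all generators, each matrix
    of syzygies is again linear and has down-set ideals as successive colon ideals,
    which yields the linear resolution of the residue field ([asl_koszul]). *)

(** * Linear combinations of words *)

Section WordSpan.
Variables (k : fieldType) (A : algType k) (H : choiceType) (h : H -> A).
Implicit Types (f g : {freealg k[H]}) (w u : {fmonom H}) (Q : {fmonom H} -> Prop).

Definition wprod (s : seq H) : A := \prod_(c <- s) h c.

Lemma free_evalE f : free_eval h f = \sum_(u <- msupp f) f@_u *: wprod u.
Proof.
by rewrite /free_eval /mmap; apply: eq_bigr => u _; rewrite /= mulr_algl.
Qed.

Lemma free_evalU c w : free_eval h << c *g w >> = c *: wprod w.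
Proof. by rewrite /free_eval mmapU /= mulr_algl. Qed.

(** The predicate [Q] bounds the words that may occur, so that standard,
    bounded and two-letter expansions are handled alike. *)
Definition spanned Q (y : A) : Prop :=
  exists2 f, (forall u, u \in msupp f -> Q u) & free_eval h f = y.

Lemma spanned_word Q w : Q w -> spanned Q (wprod w).
Proof.
move=> Qw; exists << w >>; last by rewrite free_evalU scale1r.
by move=> u; rewrite msuppU1 in_fset1 => /eqP ->.
Qed.

Lemma spanned0 Q : spanned Q 0.
Proof. by exists 0; [move=> u; rewrite msupp0 | rewrite raddf0]. Qed.

Lemma spannedZD Q (c : k) y z : spanned Q y -> spanned Q z ->
  spanned Q (c *: y + z).
Proof.
move=> [f Qf <-] [g Qg <-]; exists (c *: f + g); last by rewrite linearP.
move=> u /(fsubsetP (msuppD_le _ _)); rewrite in_fsetU => /orP[|/Qg//].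
by move=> /(fsubsetP (msuppZ_le _ _))/Qf.
Qed.

Lemma spannedZ Q (c : k) y : spanned Q y -> spanned Q (c *: y).
Proof. by move=> Qy; rewrite -[_ *: _]addr0; apply/spannedZD/spanned0. Qed.

Lemma spannedD Q y z : spanned Q y -> spanned Q z -> spanned Q (y + z).
Proof. by move=> Qy Qz; rewrite -[y]scale1r; apply: spannedZD. Qed.

Lemma spannedN Q y : spanned Q y -> spanned Q (- y).
Proof. by move=> Qy; rewrite -scaleN1r; apply: spannedZ. Qed.

Lemma spanned_sum Q (J : eqType) (r : seq J) (P : pred J) (F : J -> A) :
  (forall j, j \in r -> P j -> spanned Q (F j)) ->
  spanned Q (\sum_(j <- r | P j) F j).
Proof.
move=> QF; rewrite big_seq_cond; apply: big_ind => [||j /andP[]].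
- exact: spanned0.
- exact: spannedD.
- exact: QF.
Qed.

Lemma spanned_bind Q Q' y : spanned Q y ->
  (forall u, Q u -> spanned Q' (wprod u)) -> spanned Q' y.
Proof.
move=> [f Qf <-] QQ'; rewrite free_evalE; apply: spanned_sum => u /Qf Qu _.
exact/spannedZ/QQ'.
Qed.

End WordSpan.

(** * The degree-lexicographic order on words *)

Section LinearExtension.
Variables (d : Order.disp_t) (H : finPOrderType d).

(** Counting the elements below [x] makes the rank monotone, and [enum_rank]
    breaks the ties: this is a linear extension of [H]. *)
Definition lrank (x : H) : nat :=
  (#|[pred y : H | (y <= x)%O]| * #|H| + enum_rank x)%N.

Lemma lrank_lt x y : (x < y)%O -> (lrank x < lrank y)%N.
Proof.
move=> xy; have lt_card : (#|[pred z : H | (z <= x)%O]| <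
    #|[pred z : H | (z <= y)%O]|)%N.
  apply: proper_card; apply/properP; split.
    by apply/subsetP => z; rewrite !inE => zx; apply: le_trans zx (ltW xy).
  by exists y; rewrite !inE // lt_geF.
have := leq_mul lt_card (leqnn #|H|).
rewrite mulSn addnC => le; apply: leq_trans (leq_addr _ _).
by apply: leq_trans le; rewrite -addnS leq_add2l.
Qed.

Lemma lrank_inj : injective lrank.
Proof.
move=> x y; rewrite /lrank => e; apply/enum_rank_inj/val_inj => /=.
have := congr1 (modn^~ #|H|) e.
by rewrite !modnMDl !modn_small.
Qed.

Definition lbase : nat := (#|H| * #|H| + #|H|).+2.

Lemma lrank_bound x : ((lrank x).+2 < lbase)%N.
Proof.
have le := leq_mul (max_card [pred y : H | (y <= x)%O]) (leqnn #|H|).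
have := leq_add le (ltn_ord (enum_rank x)); by rewrite addnS.
Qed.

(** The numeral with digits [lrank + 1] in base [lbase]: as no digit is zero,
    comparing these numerals is comparing the words degree-lexicographically. *)
Definition code (s : seq H) : nat :=
  foldl (fun n c => n * lbase + (lrank c).+1)%N 0%N s.

Lemma code_foldl n s : foldl (fun n c => n * lbase + (lrank c).+1)%N n s =
  (n * lbase ^ size s + code s)%N.
Proof.
rewrite /code; elim: s n => [|c s IH] n /=; first by rewrite expn0; lia.
by rewrite IH [in RHS]IH mul0n expnS; lia.
Qed.

Lemma code_cat s1 s2 : code (s1 ++ s2) = (code s1 * lbase ^ size s2 + code s2)%N.
Proof. by rewrite /code foldl_cat code_foldl. Qed.

Lemma code_cons c s : code (c :: s) = ((lrank c).+1 * lbase ^ size s + code s)%N.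
Proof. by rewrite -cat1s code_cat /code /= mul0n. Qed.

Lemma code_lt s : (code s < lbase ^ size s)%N.
Proof.
elim: s => [|c s IH] /=; first by rewrite expn0.
rewrite code_cons expnS; have := lrank_bound c; nia.
Qed.

(** Digits are nonzero, so a longer word has a larger numeral. *)
Lemma code_size s1 s2 : (code s1 <= code s2)%N -> (size s1 <= size s2)%N.
Proof.
case: s1 => [//|c s1]; rewrite code_cons => le12.
have b1 : (1 < lbase)%N by [].
rewrite -(ltn_exp2l _ _ b1); apply: leq_ltn_trans (code_lt s2).
by apply: leq_trans le12; rewrite mulSn -addnA leq_addr.
Qed.

Lemma code_cat_mono s1 s2 x y : (code s1 <= code s2)%N ->
  (code (x ++ s1 ++ y) <= code (x ++ s2 ++ y))%N.
Proof.
move=> le12; rewrite !code_cat !size_cat.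
have le_exp : (lbase ^ (size s1 + size y) <= lbase ^ (size s2 + size y))%N.
  by rewrite leq_exp2l // leq_add2r code_size.
by rewrite leq_add ?leq_mul2l ?le_exp ?orbT // leq_add2r leq_mul2r le12 orbT.
Qed.

Lemma code_inj : injective code.
Proof.
elim=> [|c s IH] [|c' s'] e //.
- by have := @code_size (c' :: s') [::]; rewrite e => /(_ (leqnn _)).
- by have := @code_size (c :: s) [::]; rewrite e => /(_ (leqnn _)).
have es : size s = size s'.
  apply/eqP; rewrite eqn_leq; have := @code_size (c :: s) (c' :: s').
  have := @code_size (c' :: s') (c :: s); rewrite e leqnn /= !ltnS.
  by move=> /(_ isT) -> /(_ isT) ->.
move: e; rewrite !code_cons es => e; have b := code_lt s; have b' := code_lt s'.
rewrite es in b.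
have ec : lrank c = lrank c'.
  have := congr1 (divn^~ (lbase ^ size s')%N) e.
  by rewrite !divnMDl ?expn_gt0 // !divn_small // !addn0 => -[].
by rewrite (lrank_inj ec) (IH s') //; move: e; rewrite ec => /addnI.
Qed.

Lemma code_lt_cat s1 s2 x y : (code s1 < code s2)%N ->
  (code (x ++ s1 ++ y) < code (x ++ s2 ++ y))%N.
Proof.
move=> lt12; rewrite ltn_neqAle code_cat_mono ?(ltnW lt12) // andbT.
apply/eqP => /code_inj /eqP; rewrite eqseq_cat // eqxx /=.
have sz : size x = size x by [].
have [es|ns] := eqVneq (size s1) (size s2).
  by rewrite eqseq_cat // => /andP[/eqP e _]; rewrite e ltnn in lt12.
by move/eqP/(congr1 size)/eqP; rewrite !size_cat eqn_add2r (negbTE ns).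
Qed.

Lemma code2_lt (x y z t : H) : (lrank x < lrank y)%N ->
  (code [:: x; z] < code [:: y; t])%N.
Proof.
move=> lt_xy; rewrite !code_cons /= expn1 expn0 /code /=.
have := lrank_bound z; nia.
Qed.

Definition deglex : rel {fmonom H} := fun u v => (code u <= code v)%N.

Lemma deglex_word_order : word_order deglex.
Proof.
split.
- by move=> u v; apply: leq_total.
- move=> u v; rewrite /deglex -eqn_leq => /eqP/code_inj e.
  by apply/eqP; rewrite fmP e.
- by move=> v u w; apply: leq_trans.
- move=> u; have [n] := ubnP (code u).
  elim: n u => [|n IH] u lt_un; first by rewrite ltn0 in lt_un.
  constructor=> v /andP[nvu le_vu]; apply: IH.
  have: (code v < code u)%N; last by move/leq_trans; apply.
  rewrite ltn_neqAle [(_ <= _)%N]le_vu andbT.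
  by apply: contra nvu => /eqP/code_inj e; rewrite fmP e.
- by move=> u v x y uv; rewrite /deglex !fmM -!catA; apply: code_cat_mono.
Qed.

End LinearExtension.

(** * Straightening words *)

Lemma nle_nlt_incomparable d (H : porderType d) (x y : H) :
  ~~ (x <= y)%O -> ~~ (y < x)%O -> (x >< y)%O.
Proof.
move=> nxy nyx; rewrite /Order.comparable negb_or nxy /=.
apply: contra nyx => yx; rewrite lt_neqAle yx andbT.
by apply: contra nxy => /eqP ->.
Qed.

Lemma unsortedP d (H : porderType d) (s : seq H) : ~~ sorted <=%O s ->
  exists s1 x y s2, s = s1 ++ [:: x; y] ++ s2 /\ ~~ (x <= y)%O.
Proof.
elim: s => [//|x [//|y s] IH] /=; rewrite negb_and.
case/boolP: (x <= y)%O => [xy /= ns|nxy _]; last by exists [::], x, y, s.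
by have [s1 [x' [y' [s2 [-> n]]]]] := IH ns; exists (x :: s1), x', y', s2.
Qed.

Definition down_closed d (H : finPOrderType d) (O : {set H}) : Prop :=
  forall x y : H, (x <= y)%O -> y \in O -> x \in O.

Section Straightening.
Variables (k : fieldType) (A : comAlgType k) (d : Order.disp_t).
Variables (H : finPOrderType d) (h : H -> A).

(** The straightening axiom in degree two, where the factor below both [c] and
    [e] can be taken to be the first letter of a standard word. *)
Definition straightens : Prop := forall c e : H, (c >< e)%O ->
  spanned h (fun w => exists z z', [/\ w = [:: z; z'] :> seq H, (z <= z')%O,
    (z < c)%O & (z < e)%O]) (h c * h e).

Hypothesis straight : straightens.

(** A pair of adjacent letters that is out of order is swapped if comparable and
    straightened otherwise; both lower the letter in the first place, hence
    [code]. A down-set containing a letter of the pair contains one of the new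
    letters, because straightening brings in a letter below both. *)
Lemma straighten_word (s : seq H) :
  spanned h (fun u => [/\ sorted <=%O (u : seq H), size u = size s,
    (code u <= code s)%N & forall O : {set H}, down_closed O ->
      has (mem O) s -> has (mem O) u]) (wprod h s).
Proof.
have [n] := ubnP (code s); elim: n s => [|n IH] s; first by rewrite ltn0.
rewrite ltnS => len.
have [ss|/unsortedP[s1 [x [y [s2 [es nxy]]]]]] := boolP (sorted <=%O s).
  by have -> : s = FMonom s :> seq H by []; apply: spanned_word.
have bind s' : (code s' < code s)%N -> size s' = size s ->
    (forall O : {set H}, down_closed O -> has (mem O) s -> has (mem O) s') ->
    spanned h (fun u => [/\ sorted <=%O (u : seq H), size u = size s,
    (code u <= code s)%N & forall O : {set H}, down_closed O ->
      has (mem O) s -> has (mem O) u]) (wprod h s').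
  move=> cs' zs' Os'; have := IH s' (leq_trans cs' len).
  move=> sp; apply: spanned_bind sp _ => u [su zu cu Ou].
  apply: spanned_word; split=> //; first by rewrite zu zs'.
    exact: leq_trans cu (ltnW cs').
  by move=> O dO /(Os' O dO)/(Ou O dO).
have prodE t : wprod h (s1 ++ t ++ s2) = wprod h t * (wprod h s1 * wprod h s2).
  by rewrite /wprod !big_cat /= mulrCA.
have [yx|nyx] := boolP (y < x)%O.
  have -> : wprod h s = wprod h (s1 ++ [:: y; x] ++ s2).
    by rewrite es !prodE /wprod !big_cons [h x * _]mulrCA.
  apply: bind.
  - by rewrite es; apply/code_lt_cat/code2_lt/lrank_lt.
  - by rewrite es !size_cat.
  - by move=> O _; rewrite es !has_cat /= [mem O x || _]orbCA.
have inc := nle_nlt_incomparable nxy nyx.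
have [f fP fE] := straight inc.
rewrite es prodE {1}/wprod !big_cons big_nil mulr1 -es -fE free_evalE mulr_suml.
apply: spanned_sum => u /fP[z [z' [eu zz' zx zy]]] _.
rewrite -scalerAl -prodE eu; apply: spannedZ; apply: bind.
- by rewrite es; apply/code_lt_cat/code2_lt/lrank_lt.
- by rewrite es !size_cat.
move=> O dO; rewrite es !has_cat /= => /or3P[->//| |->]; last by rewrite !orbT.
rewrite orbF => /orP[xO|yO].
  by rewrite (dO z x (ltW zx) xO) !orbT.
by rewrite (dO z y (ltW zy) yO) !orbT.
Qed.

End Straightening.

(** * Graded algebras *)

Section Parts.
Variables (K : choiceType) (G : zmodType).
Implicit Types (f : {malg G[K]}) (P : pred K).

Definition mpart P f : {malg G[K]} :=
  [malg u in msupp f => if P u then f@_u else 0].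

Lemma mpartE P f u : (mpart P f)@_u = if P u then f@_u else 0.
Proof. by rewrite mcoeffE; case: (msuppP f u) => //; rewrite if_same. Qed.

Lemma mem_mpart P f u : (u \in msupp (mpart P f)) = P u && (u \in msupp f).
Proof.
by rewrite -!mcoeff_neq0 mpartE; case: (P u) => //=; rewrite eqxx.
Qed.

Lemma mpartC P f : f = mpart P f + mpart (predC P) f.
Proof.
by apply/malgP => u; rewrite mcoeffD !mpartE /=; case: (P u); rewrite ?addr0 ?add0r.
Qed.

Lemma mpart_sum (deg : K -> nat) N f : (forall u, u \in msupp f -> (deg u < N)%N) ->
  f = \sum_(e < N) mpart (fun u => deg u == e) f.
Proof.
move=> fN; apply/malgP => u; rewrite raddf_sum /=.
under eq_bigr do rewrite mpartE.
case: (msuppP f u) => [/fN uN|_]; last by rewrite big1 // => i; rewrite if_same.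
by rewrite -big_mkcond (big_pred1 (Ordinal uN)) // => i; rewrite eq_sym.
Qed.

Lemma msupp_degree_bound (deg : K -> nat) f :
  exists N, forall u, u \in msupp f -> (deg u < N)%N.
Proof.
exists (\max_(u <- msupp f) (deg u).+1)%N => u uf.
by rewrite (big_fsetD1 u) //= leq_max ltnSn.
Qed.
End Parts.

Section GradedAlgebras.
Variables (k : fieldType) (A : algType k) (gr : nat -> A -> Prop).
Hypothesis grA : graded_algebra gr.

Lemma grD d x y : gr d x -> gr d y -> gr d (x + y).
Proof. by move=> gx gy; rewrite -[x]scale1r; apply: (gr_lin grA). Qed.

Lemma grZ d c x : gr d x -> gr d (c *: x).
Proof.
move=> gx; rewrite -[_ *: x]addr0; apply: (gr_lin grA) => //.
exact: (gr_zero grA).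
Qed.

Lemma gr_sum d (J : Type) (r : seq J) (P : pred J) (F : J -> A) :
  (forall j, P j -> gr d (F j)) -> gr d (\sum_(j <- r | P j) F j).
Proof.
move=> gF; apply: big_ind => // [|x y]; [exact: (gr_zero grA)|exact: grD].
Qed.

Lemma graded_component N (f : nat -> A) d y : (forall e, gr e (f e)) -> gr d y ->
  \sum_(e < N) f e = y -> (d < N)%N ->
  f d = y /\ (forall e, (e < N)%N -> e != d -> f e = 0).
Proof.
move=> gf gy sumE dN.
pose f' e := f e - (if e == d then y else 0).
have gf' e : gr e (f' e).
  apply: grD => //; rewrite -scaleN1r; apply: grZ.
  by case: eqP => [->//|_]; apply: (gr_zero grA).
have f'0 : \sum_(e < N) f' e = 0.
  rewrite big_split /= sumrN -big_mkcond /= sumE.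
  by rewrite (big_pred1 (Ordinal dN)) ?subrr // => i.
have z := gr_direct grA gf' f'0; split.
  by have /eqP := z d dN; rewrite /f' eqxx subr_eq0 => /eqP.
by move=> e eN ned; have := z e eN; rewrite /f' (negbTE ned) subr0.
Qed.

Lemma graded_decomposition x : exists N (g : nat -> A), (forall e, gr e (g e)) /\
  forall M, (N <= M)%N -> x = \sum_(e < M) g e.
Proof.
have [N [f [gf ->]]] := gr_span grA x.
exists N, (fun e => if (e < N)%N then f e else 0); split=> [e|M NM].
  by case: ifP => // _; apply: (gr_zero grA).
rewrite (big_ord_widen M f NM) big_mkcond /=.
by apply: eq_bigr.
Qed.

(** Since the rows of [D] have degree one, only the components of degree one of
    the coefficients contribute to degree two. *)
Lemma linear_solution r s (D : 'M[A]_(r, s)) (u : 'rV[A]_r) (y : 'rV[A]_s) :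
  (forall i j, gr 1 (D i j)) -> (forall j, gr 2 (y 0 j)) -> y = u *m D ->
  exists u' : 'rV[A]_r, [/\ forall i, gr 1 (u' 0 i), y = u' *m D
    & forall i, u 0 i = 0 -> u' 0 i = 0].
Proof.
move=> gD gy yE.
have /fin_all_exists[N /fin_all_exists[g gP]] :
  forall i, exists N (g : nat -> A), (forall e, gr e (g e)) /\
    forall M, (N <= M)%N -> u 0 i = \sum_(e < M) g e.
  by move=> i; apply: graded_decomposition.
pose M := (\max_i N i).+2.
have uE i : u 0 i = \sum_(e < M) g i e.
  by apply: (gP i).2; rewrite /M !leqW // leq_bigmax.
have gg i e : gr e (g i e) by apply: (gP i).1.
exists (\row_i g i 1%N); split=> [i||i ui0].
- by rewrite mxE.
- apply/rowP => j; rewrite mxE.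
  pose F e := if e is e'.+1 then \sum_i g i e' * D i j else 0.
  have gF e : gr e (F e).
    case: e => [|e]; first exact: (gr_zero grA).
    by apply: gr_sum => i _; rewrite -addn1; apply: (gr_mul grA).
  have sumF : \sum_(e < M.+1) F e = y 0 j.
    rewrite big_ord_recl add0r yE mxE exchange_big /=.
    by apply: eq_bigr => i _; rewrite uE mulr_suml.
  have [<- _] := graded_component gF (gy j) sumF (isT : 2 < M.+1)%N.
  by apply: eq_bigr => i _; rewrite mxE.
have z0 : gr 0 0 by apply: (gr_zero grA).
have sum0 : \sum_(e < M) g i e = 0 by rewrite -uE.
have [_ z] := graded_component (gg i) z0 sum0 (isT : 0 < M)%N.
by rewrite mxE z.
Qed.
End GradedAlgebras.

(** * Algebras with straightening law *)

(** The axioms speak about the standard expansion of a product; by independence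
    it is the one that [straightens] provides. *)
Theorem straightening_asl (k : fieldType) (A : comAlgType k) (gr : nat -> A -> Prop)
    (d : Order.disp_t) (H : finPOrderType d) (h : H -> A) :
  graded_algebra gr -> (forall c, gr 1 (h c)) -> (forall x, spanned h (fun=> True) x) ->
  straightens h -> (forall f, standard f -> free_eval h f = 0 -> f = 0) ->
  algebra_with_straightening_law gr h.
Proof.
move=> grA deg1 gen str indep.
have inj (f g : {freealg k[H]}) : standard f -> standard g ->
    free_eval h f = free_eval h g -> f = g.
  move=> sf sg e; apply/eqP; rewrite -subr_eq0; apply/eqP; apply: indep.
    by move=> w /(fsubsetP (msuppB_le _ _)); rewrite in_fsetU => /orP[/sf|/sg].
  by rewrite raddfB /= e subrr.
split=> //.
- move=> c e ce; have : << FMonom [:: c] >> = << FMonom [:: e] >> :> {freealg k[H]}.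
    apply: inj.
    + by move=> w; rewrite msuppU1 in_fset1 => /eqP ->.
    + by move=> w; rewrite msuppU1 in_fset1 => /eqP ->.
    by rewrite !free_evalU /wprod !big_cons !big_nil ce.
  move=> /(congr1 (mcoeff (FMonom [:: c]))); rewrite mcoeffUU mcoeffU.
  by case: eqP => [[->]//|_ /eqP]; rewrite oner_eq0.
- by move=> x; have [f _ fE] := gen x; exists f.
- move=> x; have [f fs fE] : spanned h (fun w => sorted <=%O (w : seq H)) x.
    apply: spanned_bind (gen x) _ => u _.
    apply: spanned_bind (straighten_word str u) _ => v [sv _ _ _].
    exact: spanned_word.
  exists f; split=> [//|g [sg gE]]; apply: inj => //.
  by rewrite fE gE.
move=> c e f inc sf fE w wf; have [g gP gE] := str c e inc.
have fg : f = g.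
  apply: inj => //; last by rewrite fE gE.
  by move=> v /gP[z [z' [-> zz' _ _]]] /=; rewrite zz'.
have [|z [z' [wE _ zc ze]]] := gP w; first by rewrite -fg.
by exists z => //; rewrite wE mem_head.
Qed.

Section ASLTheory.
Variables (k : fieldType) (A : comAlgType k) (gr : nat -> A -> Prop).
Variables (d : Order.disp_t) (H : finPOrderType d) (h : H -> A).
Hypothesis asl : algebra_with_straightening_law gr h.
Let grA := asl_graded asl.

Lemma wprod_gr (s : seq H) : gr (size s) (wprod h s).
Proof.
rewrite /wprod; elim: s => [|c s IH].
  by rewrite big_nil; apply/(gr0P grA); exists 1; rewrite scale1r.
by rewrite big_cons -[size _]/(1 + size s)%N; apply: (gr_mul grA) => //; apply: (asl_deg1 asl).
Qed.

Lemma standard_inj (f g : {freealg k[H]}) : standard f -> standard g ->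
  free_eval h f = free_eval h g -> f = g.
Proof.
move=> sf sg e; have [f0 [_ u]] := asl_basis asl (free_eval h f).
by rewrite -(u f) // -(u g).
Qed.

Lemma standard_part (P : pred {fmonom H}) (f : {freealg k[H]}) :
  standard f -> standard (mpart P f).
Proof. by move=> sf u; rewrite mem_mpart => /andP[_ /sf]. Qed.

(** The parts of the expansion in other degrees evaluate to zero, so they vanish
    by uniqueness of standard expansions. *)
Lemma standard_homogeneous (f : {freealg k[H]}) n : standard f ->
  gr n (free_eval h f) -> forall u, u \in msupp f -> size u = n.
Proof.
move=> sf gf u uf; have [N0 N0P] := msupp_degree_bound (@fdeg H) f.
pose N := maxn N0 n.+1; pose part e := mpart (fun u => fdeg u == e) f.
have fE : f = \sum_(e < N) part e.
  by apply: mpart_sum => v /N0P; rewrite leq_max => ->.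
have gpart e : gr e (free_eval h (part e)).
  rewrite free_evalE big_seq_cond; apply: gr_sum => // v /andP[].
  rewrite mem_mpart => /andP[/eqP<- _] _; apply: grZ => //; exact: wprod_gr.
have [||_ z] := graded_component grA gpart gf (N := N); last first.
- apply/eqP; apply: contraLR uf => nu.
  have uN : (fdeg u < N)%N \/ u \notin msupp f.
    by case/boolP: (u \in msupp f) => [/N0P uN|]; [left; rewrite leq_max uN|right].
  case: uN => // uN.
  have p0 : part (fdeg u) = 0.
    apply: standard_inj; [exact: standard_part|by move=> v; rewrite msupp0|].
    by rewrite z // raddf0.
  have := congr1 (mcoeff u) p0; rewrite mpartE eqxx mcoeff0 => /eqP.
  by rewrite mcoeff_eq0.
- by rewrite leq_max ltnSn orbT.
by rewrite [in RHS]fE raddf_sum.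
Qed.

Lemma asl_straightens : straightens h.
Proof.
move=> c e inc; have [f [[sf fE] _]] := asl_basis asl (h c * h e).
exists f => // u uf.
have /(standard_homogeneous sf) : gr 2 (free_eval h f).
  by rewrite fE -[2%N]/(1 + 1)%N; apply: (gr_mul grA); apply: (asl_deg1 asl).
move=> /(_ u uf); have := sf u uf; have := asl_straightening asl inc sf fE uf.
case: u {uf} => [[|x [|y [|]]]] //= [z].
rewrite !inE => zxy [zc ze]; rewrite andbT => xy _; exists x, y.
suff xz : (x <= z)%O by rewrite (le_lt_trans xz zc) (le_lt_trans xz ze).
by case/orP: zxy => /eqP ->.
Qed.

Lemma asl_spanned (a : A) : spanned h (fun u => sorted <=%O (u : seq H)) a.
Proof. by have [f [[sf fE] _]] := asl_basis asl a; exists f. Qed.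

(** In the degree-lexicographic order of a linear extension, an unsorted pair is
    larger than the words that replace it when it is swapped or straightened, so
    each unsorted word contains the leading word of a quadratic relation. A
    relation with a sorted leading word would straighten to a nontrivial linear
    relation between standard monomials. *)
Theorem asl_groebner : quadratic_groebner_presentation h.
Proof.
split; first exact: (asl_generated asl).
exists (@deglex d H), (fun g => quadratic g /\ free_eval h g = 0).
split=> [|g []//|]; first exact: deglex_word_order.
split=> [g []//|f w f0 [wf wmax]].
have [sw|nsw] := boolP (sorted <=%O (w : seq H)).
  have [g gP gE] : spanned h (fun u => sorted <=%O (u : seq H) /\
      (code u < code w)%N) (f@_w *: wprod h w).
    have -> : f@_w *: wprod h w =
        - \sum_(u <- msupp f | u != w) f@_u *: wprod h u.
      apply/eqP; rewrite -addr_eq0; apply/eqP; rewrite -[RHS]f0 free_evalE.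
      by rewrite [RHS](bigD1_seq w) ?fset_uniq.
    apply/spannedN/spanned_sum => u uf nuw; apply: spannedZ.
    have ltu : (code u < code w)%N.
      rewrite ltn_neqAle [(_ <= _)%N]wmax // andbT.
      by apply: contra nuw => /eqP/code_inj e; rewrite fmP e.
    apply: spanned_bind (straighten_word asl_straightens u) _ => v [sv _ cv _].
    by apply: spanned_word; split=> //; apply: leq_ltn_trans cv ltu.
  have gw : g = << f@_w *g w >>.
    apply: standard_inj; [by move=> u /gP[]| |by rewrite free_evalU].
    by move=> u /(fsubsetP msuppU_le); rewrite in_fset1 => /eqP ->.
  have /gP[_] : w \in msupp g by rewrite gw -mcoeff_neq0 mcoeffUU mcoeff_neq0.
  by rewrite ltnn.
have [s1 [x [y [s2 [ew nxy]]]]] := unsortedP nsw.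
have lead (g : {freealg k[H]}) : (forall u, u \in msupp g ->
    size u = 2%N /\ (code u < code [:: x; y])%N) ->
    free_eval h g = h x * h y ->
    exists g' u x' y', [/\ quadratic g' /\ free_eval h g' = 0,
      lead_word (@deglex d H) g' u & w = mmul (mmul x' u) y'].
  move=> gP gE; pose xy := FMonom [:: x; y].
  have sup u : u \in msupp (<< xy >> - g) -> u = xy \/ u \in msupp g.
    move/(fsubsetP (msuppB_le _ _)); rewrite in_fsetU msuppU1 in_fset1.
    by case/orP => [/eqP|]; [left|right].
  exists (<< xy >> - g), xy, (FMonom s1), (FMonom s2); split.
  - split; first by move=> u /sup[->|/gP[]].
    by rewrite raddfB /= free_evalU scale1r gE /wprod !big_cons big_nil mulr1 subrr.
  - split; last by move=> u /sup[->|/gP[_ /ltnW]] //; apply: leqnn.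
    rewrite -mcoeff_neq0 mcoeffB mcoeffUU (mcoeff_outdom (g := g)) ?subr0 ?oner_eq0 //.
    by apply/negP => /gP[_]; rewrite ltnn.
  - by apply/eqP; rewrite fmP !fmM /= -catA; apply/eqP.
have [yx|nyx] := boolP (y < x)%O.
  apply: (lead << FMonom [:: y; x] >>).
    move=> u; rewrite msuppU1 in_fset1 => /eqP -> /=; split=> //.
    exact/code2_lt/lrank_lt.
  by rewrite free_evalU scale1r /wprod !big_cons big_nil mulr1 mulrC.
have inc := nle_nlt_incomparable nxy nyx.
have [g gP gE] := asl_straightens inc; apply: (lead g) => // u /gP.
by move=> [z [z' [-> _ zx _]]]; split=> //; apply/code2_lt/lrank_lt.
Qed.

(** * Ideals generated by down-sets of letters *)

Definition letter_ideal (O : {set H}) (a : A) : Prop :=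
  exists c : H -> A, a = \sum_(z in O) c z * h z.

Section LetterIdeal.
Variable O : {set H}.

Lemma letter_idealD a b : letter_ideal O a -> letter_ideal O b ->
  letter_ideal O (a + b).
Proof.
move=> [c ->] [e ->]; exists (fun z => c z + e z).
by rewrite -big_split; apply: eq_bigr => z _; rewrite mulrDl.
Qed.

Lemma letter_idealM a b : letter_ideal O b -> letter_ideal O (a * b).
Proof.
move=> [c ->]; exists (fun z => a * c z).
by rewrite mulr_sumr; apply: eq_bigr => z _; rewrite mulrA.
Qed.

Lemma letter_ideal0 : letter_ideal O 0.
Proof. by exists (fun=> 0); rewrite big1 // => z _; rewrite mul0r. Qed.

Lemma letter_ideal_sum (J : eqType) (r : seq J) (P : pred J) (F : J -> A) :
  (forall j, j \in r -> P j -> letter_ideal O (F j)) ->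
  letter_ideal O (\sum_(j <- r | P j) F j).
Proof.
move=> IF; rewrite big_seq_cond; apply: big_ind => [||j /andP[]].
- exact: letter_ideal0.
- exact: letter_idealD.
- exact: IF.
Qed.

Lemma letter_ideal_letter z : z \in O -> letter_ideal O (h z).
Proof.
move=> zO; exists (fun y => if y == z then 1 else 0).
rewrite (bigD1 z) //= eqxx mul1r big1 ?addr0 // => y /andP[_ /negbTE ->].
by rewrite mul0r.
Qed.

Lemma letter_ideal_word (s : seq H) : has (mem O) s -> letter_ideal O (wprod h s).
Proof.
move=> /hasP[z zs zO]; rewrite /wprod (big_rem z) //= mulrC.
exact/letter_idealM/letter_ideal_letter.
Qed.

Lemma letter_ideal_spanned a (Q : {fmonom H} -> Prop) : spanned h Q a ->
  (forall u, Q u -> has (mem O) u) -> letter_ideal O a.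
Proof.
move=> [f fQ <-] QO; rewrite free_evalE; apply: letter_ideal_sum => u /fQ/QO uO _.
by rewrite -mulr_algl; apply/letter_idealM/letter_ideal_word.
Qed.

(** Straightening keeps a word in a down-set, so such an ideal is spanned by the
    standard monomials that it contains. *)
Lemma letter_ideal_standard a : down_closed O -> letter_ideal O a ->
  spanned h (fun u => sorted <=%O (u : seq H) /\ has (mem O) u) a.
Proof.
move=> dO [c ->]; apply: spanned_sum => z _ zO; rewrite mulrC.
have [f sf <-] := asl_spanned (c z); rewrite free_evalE mulr_sumr.
apply: spanned_sum => u _ _; rewrite -scalerAr; apply: spannedZ.
have -> : h z * wprod h u = wprod h (z :: u) by rewrite /wprod big_cons.
apply: spanned_bind (straighten_word asl_straightens _) _ => v [sv _ _ vO].
by apply: spanned_word; split=> //; apply: vO; rewrite //= [_ \in _]zO.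
Qed.
End LetterIdeal.

Definition not_above (z : H) : {set H} := [set y | ~~ (z <= y)%O].

Lemma not_above_down z : down_closed (not_above z).
Proof. by move=> x y xy; rewrite !inE; apply: contra => zx; apply: le_trans xy. Qed.

(** The ideals of down-sets form a Koszul filtration: their colon ideals by a
    minimal further letter [z] are of the same kind. A letter that is not above
    [z] lies in [O] if it is below [z], and otherwise its product with [z]
    straightens into [O]. Conversely, putting [z] in front of a standard word
    with letters above [z] gives a standard word, which misses [O]. *)
Lemma letter_ideal_colon (O : {set H}) z a : down_closed O -> z \notin O ->
  (forall y, (y < z)%O -> y \in O) ->
  letter_ideal O (a * h z) <-> letter_ideal (not_above z) a.
Proof.
move=> dO zO minz; have back b : letter_ideal (not_above z) b -> letter_ideal O (b * h z).
  move=> [c ->]; rewrite mulr_suml; apply: letter_ideal_sum => y _.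
  rewrite inE => nzy; rewrite -mulrA; apply: letter_idealM.
  have [yz|nyz] := boolP (y < z)%O.
    by rewrite mulrC; apply/letter_idealM/letter_ideal_letter/minz.
  have inc : (y >< z)%O by rewrite comparable_sym nle_nlt_incomparable.
  apply: letter_ideal_spanned (asl_straightens inc) _ => u [x [x' [-> _ _ xz]]].
  by rewrite /= [_ \in _]minz.
split=> [Iaz|]; last exact: back.
have [f sf fE] := asl_spanned a; pose P := fun u : {fmonom H} => all (fun y => (z <= y)%O) u.
pose g := mpart P f; pose g' := mpart (predC P) f.
have aE : a = free_eval h g + free_eval h g' by rewrite -raddfD -mpartC.
have Ig' : letter_ideal (not_above z) (free_eval h g').
  apply: (@letter_ideal_spanned _ _ (fun u => ~~ P u)) => [|u].

    by exists g' => // u; rewrite mem_mpart => /andP[].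
  by rewrite -has_predC; apply: sub_has => y /=; rewrite inE.
suff g0 : g = 0 by rewrite aE g0 raddf0 add0r.
have Ig : letter_ideal O (free_eval h g * h z).
  have -> : free_eval h g * h z = a * h z + (-1) * (free_eval h g' * h z).
    by rewrite aE mulrDl mulN1r addrK.
  by apply: letter_idealD => //; apply/letter_idealM/back.
pose zg : {freealg k[H]} := \sum_(u <- msupp g) << g@_u *g FMonom (z :: u) >>.
have zgE : free_eval h zg = free_eval h g * h z.
  rewrite /zg raddf_sum free_evalE mulr_suml; apply: eq_bigr => u _.
  by rewrite /= free_evalU /wprod big_cons [h z * _]mulrC scalerAl.
have [F FP FE] := letter_ideal_standard dO Ig.
have szg : standard zg.
  move=> v; rewrite -mcoeff_neq0 raddf_sum /= => nz.
  have /hasP[u ug /eqP uv] : has (fun u : {fmonom H} => FMonom (z :: u) == v) (msupp g).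
    apply: contraNT nz => /hasPn n; apply/eqP; rewrite big_seq big1 // => u ug.
    by rewrite mcoeffU (negbTE (n u ug)).
  move: ug; rewrite mem_mpart -uv /= => /andP[Pu uf].
  by rewrite path_min_sorted ?sf.
have FG : F = zg by apply: standard_inj => // [u /FP[]//|]; rewrite FE zgE.
apply/malgP => u; rewrite mcoeff0; apply/eqP; apply: contraT; rewrite mcoeff_neq0 => ug.
have : FMonom (z :: u) \in msupp F.
  rewrite FG -mcoeff_neq0 raddf_sum /= (bigD1_seq u) ?fset_uniq //= mcoeffUU.
  rewrite big1 ?addr0 ?mcoeff_neq0 // => v nvu; rewrite mcoeffU.
  case: eqP => // -[] e; case/negP: nvu; by rewrite fmP e.
move=> /FP[_] /=; rewrite [_ \in _](negbTE zO) /=.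
move: ug; rewrite mem_mpart => /andP[/allP Pu _] /hasP[y yu yO].
by rewrite (dO z y) // in zO; apply: Pu.
Qed.

End ASLTheory.

(** * The linear resolution of the residue field *)

Section ASLKoszul.
Variables (k : fieldType) (A : comAlgType k) (gr : nat -> A -> Prop).
Variables (d : Order.disp_t) (H : finPOrderType d) (h : H -> A).
Hypothesis asl : algebra_with_straightening_law gr h.
Let grA := asl_graded asl.

Section RowSpan.
Variables (r s : nat) (D : 'M[A]_(r, s)) (rk : 'I_r -> nat).

Definition supported_below n (v : 'rV[A]_r) : Prop :=
  forall i, (n <= rk i)%N -> v 0 i = 0.

Definition span_below n (y : 'rV[A]_s) : Prop :=
  exists2 u, supported_below n u & y = u *m D.

Lemma span_below_lin n a y z : span_below n y -> span_below n z ->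
  span_below n (a *: y + z).
Proof.
move=> [u un ->] [v vn ->]; exists (a *: u + v).
  by move=> i ni; rewrite !mxE un // vn // mulr0 addr0.
by rewrite mulmxDl scalemxAl.
Qed.

Lemma span_below0 n : span_below n 0.
Proof. by exists 0; [move=> i; rewrite mxE | rewrite mul0mx]. Qed.

Lemma span_belowZ n a y : span_below n y -> span_below n (a *: y).
Proof. by move=> sy; rewrite -[_ *: _]addr0; apply/span_below_lin/span_below0. Qed.

Lemma span_below_sum n (J : finType) (P : pred J) (F : J -> 'rV[A]_s) :
  (forall j, P j -> span_below n (F j)) -> span_below n (\sum_(j | P j) F j).
Proof.
move=> sF; apply: big_ind => //; first exact: span_below0.
by move=> y z sy sz; rewrite -[y]scale1r; apply: span_below_lin.
Qed.

Lemma span_below_row n i : (rk i < n)%N -> span_below n (row i D).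
Proof.
move=> lt; exists (delta_mx 0 i); last exact: rowE.
move=> j nj; have /negbTE nji : j != i by apply: contraTneq nj => ->; rewrite -ltnNge.
by rewrite mxE nji andbF.
Qed.

Lemma span_belowW n n' y : (n <= n')%N -> span_below n y -> span_below n' y.
Proof. by move=> le [u un ->]; exists u => // i /(leq_trans le)/un. Qed.
End RowSpan.

(** The rank orders the rows, and [O] generates the annihilator of row [i] modulo
    the earlier rows. The point of this property is that matrices of syzygies
    inherit it, so that it propagates along a resolution. *)
Definition linear_quotients r s (D : 'M[A]_(r, s)) (rk : 'I_r -> nat) : Prop :=
  [/\ injective rk, forall i j, gr 1 (D i j)
    & forall i, exists2 O : {set H}, down_closed O &
        forall a, span_below D rk (rk i) (a *: row i D) <-> letter_ideal h O a].

Section Syzygies.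
Variables (r s : nat) (D : 'M[A]_(r, s)) (rk : 'I_r -> nat).
Variable O : 'I_r -> {set H}.
Hypotheses (rk_inj : injective rk) (D_lin : forall i j, gr 1 (D i j)).
Hypothesis O_down : forall i, down_closed (O i).
Hypothesis O_colon : forall i a,
  span_below D rk (rk i) (a *: row i D) <-> letter_ideal h (O i) a.

(** A letter in the colon ideal of row [i] makes this row a combination of earlier
    ones, with coefficients that [linear_solution] makes linear. *)
Lemma basic_syzygy i z : z \in O i -> exists e : 'rV[A]_r,
  [/\ forall j, gr 1 (e 0 j), e *m D = 0, e 0 i = h z
    & forall j, (rk i < rk j)%N -> e 0 j = 0].
Proof.
move=> zO; have [u un uE] := (O_colon i (h z)).2 (letter_ideal_letter h zO).
have [|u' [gu' u'E u'0]] := linear_solution grA D_lin _ uE.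
  by move=> j; rewrite !mxE -[2%N]/(1 + 1)%N; apply: (gr_mul grA) => //; apply: (asl_deg1 asl).
have u'i : u' 0 i = 0 by apply/u'0/un.
exists (h z *: delta_mx 0 i - u'); split=> [j|||j lt].
- rewrite !mxE -scaleN1r; apply: (grD grA); last exact: grZ.
  have [_ /=|_ /=] := eqVneq j i; rewrite ?eqxx ?andbF ?mulr1 ?mulr0.
    exact: (asl_deg1 asl).
  exact: (gr_zero grA).
- by rewrite mulmxBl -scalemxAl -rowE u'E subrr.
- by rewrite !mxE !eqxx mulr1 u'i subr0.
rewrite !mxE u'0 ?un ?(ltnW lt) // subr0.
have /negbTE nji : j != i by apply: contraTneq lt => ->; rewrite ltnn.
by rewrite nji andbF mulr0.
Qed.

Variable e : 'I_r -> H -> 'rV[A]_r.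
Hypothesis eP : forall i z, z \in O i ->
  [/\ forall j, gr 1 (e i z 0 j), e i z *m D = 0, e i z 0 i = h z
    & forall j, (rk i < rk j)%N -> e i z 0 j = 0].

Definition syzygy_index : {set 'I_r * H} := [set x | x.2 \in O x.1].

Definition syzygy_mx : 'M[A]_(#|syzygy_index|, r) :=
  \matrix_(x, j) e (enum_val x).1 (enum_val x).2 0 j.

(** The lexicographic order: by row of [D] first, by letter second. *)
Definition syzygy_rank (x : 'I_#|syzygy_index|) : nat :=
  rk (enum_val x).1 * lbase H + lrank (enum_val x).2.

Let lrank_base (z : H) : (lrank z < lbase H)%N.
Proof. by have := lrank_bound z; lia. Qed.

Lemma syzygy_rank_inj : injective syzygy_rank.
Proof.
move=> x y exy; apply: enum_val_inj.
have e1 : rk (enum_val x).1 = rk (enum_val y).1.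
  have := congr1 (divn^~ (lbase H)) exy.
  by rewrite /syzygy_rank !divnMDl // !divn_small ?addn0.
have e2 : lrank (enum_val x).2 = lrank (enum_val y).2.
  by move: exy; rewrite /syzygy_rank e1 => /addnI.
by move: (rk_inj e1) (lrank_inj e2); case: (enum_val x) (enum_val y) => [? ?] [? ?] /= -> ->.
Qed.

Lemma syzygy_rank_lt x i (z : H) : (syzygy_rank x < rk i * lbase H + lrank z)%N ->
  (rk (enum_val x).1 < rk i)%N \/
  ((enum_val x).1 = i /\ (lrank (enum_val x).2 < lrank z)%N).
Proof.
rewrite /syzygy_rank; case: (ltngtP (rk (enum_val x).1) (rk i)) => [|lt|/rk_inj ->].
- by left.
- have := leq_mul lt (leqnn (lbase H)); rewrite mulSn.
  by have := lrank_base z; lia.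
by rewrite ltn_add2l; right.
Qed.

Lemma span_below_syzygy n i z : z \in O i -> (rk i * lbase H + lrank z < n)%N ->
  span_below syzygy_mx syzygy_rank n (e i z).
Proof.
move=> zO lt; have xX : (i, z) \in syzygy_index by rewrite inE.
have -> : e i z = row (enum_rank_in xX (i, z)) syzygy_mx.
  by apply/rowP => j; rewrite !mxE enum_rankK_in.
by apply: span_below_row; rewrite /syzygy_rank enum_rankK_in.
Qed.

(** The coefficient of a syzygy at its last row lies in the colon ideal of that
    row, so multiples of basic syzygies cancel it. *)
Lemma syzygies_generated n (v : 'rV[A]_r) : supported_below rk n v ->
  v *m D = 0 -> span_below syzygy_mx syzygy_rank (n * lbase H) v.
Proof.
elim: n v => [|n IH] v vn v0.
  have -> : v = 0 by apply/rowP => i; rewrite mxE vn.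
  exact: span_below0.
have [/existsP[i /eqP rki]|/existsPn nrk] := boolP [exists i, rk i == n]; last first.
  apply: (span_belowW (n := n * lbase H)%N); first by rewrite leq_mul2r leqnSn orbT.
  by apply: IH => // i; rewrite leq_eqVlt eq_sym (negbTE (nrk i)) => /vn.
have [c vi] : letter_ideal h (O i) (v 0 i).
  apply/O_colon; exists (v 0 i *: delta_mx 0 i - v).
    move=> j; rewrite rki leq_eqVlt -{1}rki => /orP[/eqP/rk_inj <-|lt].
      by rewrite !mxE !eqxx mulr1 subrr.
    have /negbTE nji : j != i by apply: contraTneq lt => ->; rewrite rki ltnn.
    by rewrite !mxE (vn j) // subr0 nji andbF mulr0.
  by rewrite mulmxBl v0 subr0 -scalemxAl -rowE.
pose w := v - \sum_(z in O i) c z *: e i z.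
have -> : v = 1 *: (\sum_(z in O i) c z *: e i z) + w by rewrite scale1r addrC subrK.
apply: span_below_lin.
  apply: span_below_sum => z zO; apply: span_belowZ; apply: span_below_syzygy => //.
  by rewrite rki mulSn addnC ltn_add2r.
apply: (span_belowW (n := n * lbase H)%N); first by rewrite leq_mul2r leqnSn orbT.
apply: IH => [j|].
  rewrite leq_eqVlt => /orP[/eqP nj|lt]; rewrite !mxE summxE.
    have -> : j = i by apply: rk_inj; rewrite -nj.
    rewrite vi -sumrB big1 // => z /eP[_ _ ez _].
    by rewrite mxE ez subrr.
  rewrite (vn j) // sub0r big1 ?oppr0 // => z /eP[_ _ _ ez].
  by rewrite mxE ez ?rki // mulr0.
rewrite mulmxBl v0 mulmx_suml big1 ?subr0 // => z /eP[_ ez _ _].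
by rewrite -scalemxAl ez scaler0.
Qed.

Lemma syzygies_exact (v : 'rV[A]_r) : v *m D = 0 <-> exists u, v = u *m syzygy_mx.
Proof.
split=> [v0|[u ->]].
  have [|u _ ->] := @syzygies_generated (\max_i rk i).+1 v _ v0; last by exists u.
  by move=> i; rewrite ltnNge leq_bigmax.
rewrite -mulmxA; have -> : syzygy_mx *m D = 0; last exact: mulmx0.
apply/row_matrixP => x; rewrite row_mul row0.
have := enum_valP x; rewrite inE => /eP[_ <- _ _]; congr (_ *m _).
by apply/rowP => j; rewrite !mxE.
Qed.

(** At coordinate [i] the row of [(i, z)] has entry [z], and each earlier row has
    there either zero or a letter of [O i] that precedes [z] in the linear
    extension. These letters form a down-set, and [z] is minimal outside it, so
    [letter_ideal_colon] computes the colon ideal; what remains after coordinate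
    [i] is cancelled is a syzygy supported on earlier rows. *)
Lemma syzygies_linear_quotients : linear_quotients syzygy_mx syzygy_rank.
Proof.
split=> [|x j|x]; first exact: syzygy_rank_inj.
  by rewrite mxE; have := enum_valP x; rewrite inE => /eP[].
have := enum_valP x; rewrite inE.
set i := (enum_val x).1; set z := (enum_val x).2 => zO.
have rkx : syzygy_rank x = (rk i * lbase H + lrank z)%N by [].
have rowx : row x syzygy_mx = e i z by apply/rowP => j; rewrite !mxE.
have [ge eD ei ej] := eP zO.
pose B := [set y in O i | (lrank y < lrank z)%N].
have dB : down_closed B.
  move=> y y' le; rewrite !inE => /andP[y'O lt]; rewrite (O_down le y'O) /=.
  apply: leq_ltn_trans lt; move: le; rewrite le_eqVlt => /orP[/eqP ->//|].
  by move/lrank_lt/ltnW.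
have zB : z \notin B by rewrite inE ltnn andbF.
have minz y : (y < z)%O -> y \in B.
  by move=> yz; rewrite inE lrank_lt // (O_down (ltW yz) zO).
exists (not_above z); first exact: not_above_down.
move=> a; rewrite rowx rkx -(letter_ideal_colon asl a dB zB minz); split.
  move=> [u un /(congr1 (fun w : 'rV_r => w 0 i))]; rewrite !mxE ei => ->.
  apply: letter_ideal_sum => y _ _; rewrite mxE.
  have [le|lt] := leqP (rk i * lbase H + lrank z)%N (syzygy_rank y).
    by rewrite un // mul0r; apply: letter_ideal0.
  have := enum_valP y; rewrite inE => yO; have [_ _ eyi eyj] := eP yO.
  apply: letter_idealM; case: (syzygy_rank_lt lt) => [lt1|[e1 lt2]].
    by rewrite eyj //; apply: letter_ideal0.
  rewrite -e1 eyi; apply: letter_ideal_letter; rewrite inE lt2 andbT -e1.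
  exact: yO.
move=> [c aE]; pose t := \sum_(y in B) c y *: e i y.
have -> : a *: e i z = 1 *: t + (a *: e i z - t) by rewrite scale1r addrC subrK.
apply: span_below_lin.
  apply: span_below_sum => y; rewrite inE => /andP[yO lt].
  by apply/span_belowZ/span_below_syzygy => //; rewrite ltn_add2l.
apply: (span_belowW (n := rk i * lbase H)%N); first exact: leq_addr.
apply: syzygies_generated => [j|].
  rewrite leq_eqVlt => /orP[/eqP/rk_inj <-|lt]; rewrite !mxE summxE.
    rewrite ei aE -sumrB big1 // => y; rewrite inE => /andP[/eP[_ _ eyi _] _].
    by rewrite mxE eyi subrr.
  rewrite ej // mulr0 sub0r big1 ?oppr0 // => y.
  by rewrite inE => /andP[/eP[_ _ _ eyj] _]; rewrite mxE eyj // mulr0.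
rewrite mulmxBl -scalemxAl eD scaler0 mulmx_suml big1 ?subr0 // => y.
by rewrite inE => /andP[/eP[_ eyD _ _] _]; rewrite -scalemxAl eyD scaler0.
Qed.
End Syzygies.

Record linear_matrix := LinearMatrix {
  lm_rows : nat;
  lm_cols : nat;
  lm_mx : 'M[A]_(lm_rows, lm_cols);
  lm_rank : 'I_lm_rows -> nat;
  lm_quot : linear_quotients lm_mx lm_rank
}.

Record syzygy_step (L : linear_matrix) := SyzygyStep {
  ss_rows : nat;
  ss_mx : 'M[A]_(ss_rows, lm_rows L);
  ss_rank : 'I_ss_rows -> nat;
  ss_quot : linear_quotients ss_mx ss_rank;
  ss_exact : forall v : 'rV[A]_(lm_rows L),
    v *m lm_mx L = 0 <-> exists u, v = u *m ss_mx
}.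

Lemma syzygy_step_exists (L : linear_matrix) : exists _ : syzygy_step L, True.
Proof.
case: L => r s D rk [rk_inj D_lin colon].
have /fin_all_exists[O OP] : forall i, exists O : {set H}, down_closed O /\
    forall a, span_below D rk (rk i) (a *: row i D) <-> letter_ideal h O a.
  by move=> i; have [O dO cO] := colon i; exists O.
have Od i : down_closed (O i) by case: (OP i).
have Oc i a := (OP i).2 a.
have /fin_all_exists[e eP] : forall i, exists ei : H -> 'rV[A]_r,
    forall z, z \in O i -> [/\ forall j, gr 1 (ei z 0 j), ei z *m D = 0,
      ei z 0 i = h z & forall j, (rk i < rk j)%N -> ei z 0 j = 0].
  move=> i; have /fin_all_exists[ei eiP] : forall z, exists ez : 'rV[A]_r,
    z \in O i -> [/\ forall j, gr 1 (ez 0 j), ez *m D = 0,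
      ez 0 i = h z & forall j, (rk i < rk j)%N -> ez 0 j = 0]; last by exists ei.
  move=> z; have [zO|nzO] := boolP (z \in O i); last by exists 0.
  by have [ez ?] := basic_syzygy D_lin Oc zO; exists ez.
exists (@SyzygyStep (LinearMatrix (And3 rk_inj D_lin colon)) _ _ _
  (syzygies_linear_quotients rk_inj Od Oc eP) (syzygies_exact rk_inj Oc eP)).
by [].
Qed.

Definition syzygies (L : linear_matrix) : syzygy_step L :=
  proj1_sig (constructive_indefinite_description _ (syzygy_step_exists L)).

Definition letters_mx : 'M[A]_(#|H|, 1) := \matrix_(i, j) h (enum_val i).

Lemma letters_mx_quotients :
  linear_quotients letters_mx (fun i => lrank (enum_val i)).
Proof.
split=> [i j /lrank_inj/enum_val_inj//|i j|i].
  by rewrite mxE; apply: (asl_deg1 asl).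
set z := enum_val i; pose B := [set y : H | (lrank y < lrank z)%N].
have dB : down_closed B.
  move=> y y' le; rewrite !inE; apply: leq_ltn_trans; move: le.
  by rewrite le_eqVlt => /orP[/eqP ->//|/lrank_lt/ltnW].
have zB : z \notin B by rewrite inE ltnn.
have minz y : (y < z)%O -> y \in B by move=> yz; rewrite inE lrank_lt.
exists (not_above z); first exact: not_above_down.
move=> a; rewrite -(letter_ideal_colon asl a dB zB minz); split.
  move=> [u un /(congr1 (fun w : 'rV_1 => w 0 0))]; rewrite !mxE => ->.
  apply: letter_ideal_sum => y _ _; rewrite mxE.
  have [le|lt] := leqP (lrank z) (lrank (enum_val y)).
    by rewrite un // mul0r; apply: letter_ideal0.
  by apply/letter_idealM/letter_ideal_letter; rewrite inE.
move=> [c aE]; exists (\row_y if enum_val y \in B then c (enum_val y) else 0).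
  by move=> y le; rewrite mxE inE ltnNge le.
apply/rowP => j; rewrite !mxE aE big_mkcond /=.
rewrite (reindex_omap enum_val (fun y => Some (enum_rank y))) /=; last first.
  by move=> y _; rewrite enum_rankK.
apply: eq_big => [y|y _]; first by rewrite enum_valK eqxx.
by rewrite !mxE; case: ifP; rewrite // mul0r.
Qed.

Fixpoint resolution (i : nat) : linear_matrix :=
  if i is i'.+1 then LinearMatrix (ss_quot (syzygies (resolution i')))
  else LinearMatrix letters_mx_quotients.

Lemma augmentation_idealP x :
  augmentation_ideal gr x <-> letter_ideal h [set: H] x.
Proof.
split=> [[N [f [gf ->]]]|[c ->]].
  apply: letter_ideal_sum => i _ _; have [g [[sg gE] _]] := asl_basis asl (f i).
  have sp : spanned h (fun u => size u = i.+1) (f i).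
    by exists g => // u; apply: (standard_homogeneous asl sg); rewrite gE.
  by apply: letter_ideal_spanned sp _ => -[[|c u]] //= _; rewrite in_setT.
have /fin_all_exists[N /fin_all_exists[g gP]] :
  forall z, exists N (g : nat -> A), (forall e, gr e (g e)) /\
    forall M, (N <= M)%N -> c z = \sum_(e < M) g e.
  by move=> z; apply: (graded_decomposition grA).
exists (\max_z N z)%N, (fun e => \sum_z g z e * h z); split=> [e|].
  apply: (gr_sum grA) => z _; rewrite -addn1; apply: (gr_mul grA).
    exact: (gP z).1.
  exact: (asl_deg1 asl).
rewrite exchange_big /=; apply: eq_big => [z|z _]; first by rewrite in_setT.
by rewrite -mulr_suml; congr (_ * _); apply: (gP z).2; apply: leq_bigmax.
Qed.

(** The column of all letters has linear quotients, hence so has every matrix in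
    the resolution obtained by iterating syzygies. *)
Theorem asl_koszul : koszul gr.
Proof.
split=> //.
exists (fun i => lm_cols (resolution i)), (fun i => lm_mx (resolution i)).
split=> [//|i r c|v|i v]; last exact: ss_exact.
  by case: (lm_quot (resolution i)).
split=> [av|[u ->] j].
  have /augmentation_idealP[c vE] := av 0.
  exists (\row_y c (enum_val y)); apply/rowP => j; rewrite ord1 vE mxE.
  transitivity (\sum_(z in H) c z * h z); first by apply: eq_bigl => z; rewrite in_setT.
  by rewrite big_enum_val; apply: eq_bigr => y _; rewrite !mxE.
apply/augmentation_idealP; rewrite mxE; apply: letter_ideal_sum => y _ _.
by rewrite !mxE; apply/letter_idealM/letter_ideal_letter; rewrite in_setT.
Qed.
End ASLKoszul.

(** * Exchange relations between minors of polynomial matrices *)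

Lemma sub_closedD (R : zmodType) (V : R -> Prop) : V 0 ->
  (forall x y, V x -> V y -> V (x - y)) -> forall x y, V x -> V y -> V (x + y).
Proof.
move=> V0 VB x y Vx Vy; rewrite -[y]opprK; apply: (VB) => //.
by rewrite -sub0r; apply: VB.
Qed.

Lemma sub_closed_sign (R : nzRingType) (V : R -> Prop) : V 0 ->
  (forall x y, V x -> V y -> V (x - y)) ->
  forall (e : bool) x, V x -> V ((-1) ^+ e * x).
Proof.
by move=> V0 VB [] x Vx; rewrite ?mul1r // expr1 mulN1r -sub0r; apply: VB.
Qed.

Section Window.
Variables (S : comNzRingType) (V : S -> Prop).
Hypotheses (V0 : V 0) (VB : forall x y, V x -> V y -> V (x - y)).

(** [v - u], with [u] the inner and [v] the outer variable. *)
Definition diffX : {poly {poly S}} := 'X - ('X)%:P.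

Lemma coef_diffXM (F : {poly {poly S}}) a b :
  (diffX * F)`_b`_a = (if b is b'.+1 then F`_b'`_a else 0) -
                      (if a is a'.+1 then F`_b`_a' else 0).
Proof.
rewrite /diffX mulrBl !coefB coefXM coefCM coefXM.
by case: b => [|b]; case: a => [|a]; rewrite /= ?coef0.
Qed.

(** A multiple of [(v - u) ^ r] is determined, in each total degree, by its
    coefficients outside a window of [r] consecutive places: the coefficients of
    [(v - u) * G] are successive differences of those of [G], so those of [G]
    are partial sums outside a window that is shorter by one. *)
Lemma window_coefficients r F Q a c : F = diffX ^+ r * Q -> (a + r <= c.+1)%N ->
  (forall x, (x <= c)%N -> (x < a)%N || (a + r <= x)%N -> V F`_(c - x)`_x) ->
  forall x, (x <= c)%N -> V F`_(c - x)`_x.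
Proof.
have VD := sub_closedD V0 VB.
elim: r F c => [|r IH] F c FE.
  by rewrite addn0 => _ out x xc; apply: out => //; case: ltnP.
rewrite exprS -mulrA in FE; set G := _ * Q in FE.
case: c => [|c] ac out.
  by move=> x; rewrite leqn0 => /eqP->; rewrite FE coef_diffXM /= subr0.
have FG x : (x <= c.+1)%N -> F`_(c.+1 - x)`_x =
    (if (x <= c)%N then G`_(c - x)`_x else 0) -
    (if x is x'.+1 then G`_(c - x')`_x' else 0).
  move=> xc; rewrite FE coef_diffXM; congr (_ - _); last first.
    by case: x {xc} => // x; rewrite subSS.
  have [le|lt] := leqP x c; first by rewrite subSn.
  by have -> : (c.+1 - x = 0)%N by apply/eqP; rewrite subn_eq0.
have Gall : forall x, (x <= c)%N -> V G`_(c - x)`_x.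
  apply: (IH G c erefl); first by lia.
  move=> x xc /orP[lt|ge].
    elim: x xc lt => [|x IHx] xc lt.
      by have := out 0%N isT; rewrite FG // subr0; apply; rewrite lt.
    have -> : G`_(c - x.+1)`_x.+1 = F`_(c.+1 - x.+1)`_x.+1 + G`_(c - x)`_x.
      by rewrite FG ?leqW // xc subrK.
    apply: VD; first by apply: out; [apply: leqW|rewrite lt].
    by apply: IHx; lia.
  have [m] := ubnP (c - x)%N; elim: m x xc ge => // m IHm x xc ge lt.
  have -> : G`_(c - x)`_x = (if (x.+1 <= c)%N then G`_(c - x.+1)`_x.+1 else 0)
      - F`_(c.+1 - x.+1)`_x.+1.
    by rewrite FG // opprB addrC subrK.
  apply: VB; last by apply: out => //; apply/orP; right; lia.
  by case: ifP => // lt'; apply: IHm => //; lia.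
move=> x xc; rewrite FG //; apply: VB; first by case: ifP => // /Gall.
by case: x xc => // x xc; apply: Gall; lia.
Qed.
End Window.

Section MaskedLaplace.
Variable R : comNzRingType.

(** Laplace expansion along the rows in [P]: the permutations are grouped by the
    image of [P]. *)
Lemma det_mask_sum N (P : {set 'I_N}) (B : 'M[R]_N) :
  \det B = \sum_(T : {set 'I_N} | #|T| == #|P|)
    \det (\matrix_(i, j) if (i \in P) == (j \in T) then B i j else 0).
Proof.
rewrite /determinant exchange_big /=; apply: eq_bigr => s _.
pose T0 := s @: P.
have memT0 i : (s i \in T0) = (i \in P) by rewrite mem_imset //; apply: perm_inj.
rewrite (bigD1 T0) /=; last by rewrite card_imset //; apply: perm_inj.
rewrite [X in _ = _ + X]big1 ?addr0.
  by congr (_ * _); apply: eq_bigr => i _; rewrite mxE memT0 eqxx.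
move=> T /andP[_ nT]; have [i ni] : exists i, (i \in P) != (s i \in T).
  apply/existsP; apply: contraNT nT => /existsPn e; apply/eqP/setP => j.
  by rewrite -[j](permKV s) memT0; apply/esym/eqP; move: (e (s^-1 j)%g); rewrite negbK.
by rewrite (bigD1 i) //= mxE (negbTE ni) mul0r mulr0.
Qed.

(** Moving the columns in [T] to the front makes the masked matrix block
    diagonal. *)
Lemma det_mask p (T : {set 'I_(p + p)}) (Bt Bb : 'M[R]_(p, p + p)) :
  #|T| = p -> exists (e : bool) (f g : 'I_p -> 'I_(p + p)),
  [/\ injective f, forall j, (j \in T) = (j \in codom f),
      forall j, (j \in ~: T) = (j \in codom g)
    & \det (\matrix_(i, j) if (i \in [set lshift p x | x : 'I_p]) == (j \in T)
              then (col_mx Bt Bb) i j else 0) =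
      (-1) ^+ e * (\det (colsub f Bt) * \det (colsub g Bb))].
Proof.
move=> cT; have cT' : #|~: T| = p by rewrite cardsCs setCK cT card_ord addnK.
pose f (i : 'I_p) : 'I_(p + p) := enum_val (cast_ord (esym cT) i).
pose g (i : 'I_p) : 'I_(p + p) := enum_val (cast_ord (esym cT') i).
have fT i : f i \in T by apply: enum_valP.
have gT i : g i \notin T by have := enum_valP (cast_ord (esym cT') i); rewrite inE.
have f_inj : injective f by move=> i j /enum_val_inj/cast_ord_inj.
have g_inj : injective g by move=> i j /enum_val_inj/cast_ord_inj.
pose sf (j : 'I_(p + p)) := match split j with inl i => f i | inr i => g i end.
have sf_inj : injective sf.
  move=> x y; rewrite /sf; case: splitP => i ei; case: splitP => j ej e.
  - by apply: val_inj; rewrite /= ei ej (f_inj _ _ e).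
  - by have := gT j; rewrite -e fT.
  - by have := gT i; rewrite e fT.
  - by apply: val_inj; rewrite /= ei ej (g_inj _ _ e).
have sfl i : sf (lshift p i) = f i.
  by rewrite /sf; case: splitP => j /= e; [congr f; apply: val_inj|have := ltn_ord i; lia].
have sfr i : sf (rshift p i) = g i.
  rewrite /sf; case: splitP => j /= e; first by have := ltn_ord j; lia.
  by congr g; apply: val_inj; apply/eqP; rewrite -(eqn_add2l p) e.
exists (odd_perm (perm sf_inj)), f, g; split=> // [j|j|].
- apply/idP/codomP => [jT|[i ->//]].
  exists (cast_ord cT (enum_rank_in jT j)).
  by rewrite /f cast_ordK enum_rankK_in.
- apply/idP/codomP => [jT|[i ->]]; last by rewrite inE gT.
  exists (cast_ord cT' (enum_rank_in jT j)).
  by rewrite /g cast_ordK enum_rankK_in.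
set B' := \matrix_(i, j) _.
have -> : \det B' = (-1) ^+ perm sf_inj * \det (col_perm (perm sf_inj) B').
  by rewrite col_permE det_mulmx det_perm odd_permV mulrCA -expr2 sqrr_sign mulr1.
congr (_ * _).
have top_l i : lshift p i \in [set lshift p x | x : 'I_p] by apply: imset_f.
have top_r i : rshift p i \in [set lshift p x | x : 'I_p] = false.
  by apply/imsetP => -[j _] /eqP; rewrite eq_rlshift.
have -> : col_perm (perm sf_inj) B' = block_mx (colsub f Bt) 0 0 (colsub g Bb).
  apply/matrixP => x y; rewrite -[x]splitK -[y]splitK.
  case: (split x) => i; case: (split y) => j /=;
    rewrite [LHS]mxE [LHS]mxE permE ?sfl ?sfr.
  - by rewrite block_mxEul col_mxEu top_l fT mxE.
  - by rewrite block_mxEur top_l (negbTE (gT j)) [RHS]mxE.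
  - by rewrite block_mxEdl top_r fT [RHS]mxE.
  - by rewrite block_mxEdr col_mxEd top_r (negbTE (gT j)) mxE.
by rewrite det_ublock.
Qed.

(** Multiplying the bottom rows by [w] costs a factor [w ^ p] and makes all the
    [p + r] columns in [J] divisible by [w]. *)
Lemma det_scaled_block p r (w : R) (J : {set 'I_(p + p)}) (B : 'M[R]_(p + p)) :
  GRing.lreg w -> #|J| = (p + r)%N ->
  (forall i j, j \in J -> exists q, B (lshift p i) j = w * q) ->
  exists Q, \det B = w ^+ r * Q.
Proof.
move=> reg cJ div.
have /fin_all_exists[q qP] : forall i, exists qi : 'I_(p + p) -> R,
    forall j, j \in J -> B (lshift p i) j = w * qi j.
  move=> i; have /fin_all_exists[qi qiP] : forall j, exists x,
    j \in J -> B (lshift p i) j = w * x; last by exists qi.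
  by move=> j; case/boolP: (j \in J) => [/(div i)[x ->]|_]; [exists x|exists 0].
pose B' : 'M[R]_(p + p) := \matrix_(x, j) match split x with
  | inl i => if j \in J then q i j else B x j
  | inr _ => if j \in J then B x j else w * B x j end.
pose rows : 'rV[R]_(p + p) := \row_x if split x then 1 else w.
pose cols : 'rV[R]_(p + p) := \row_j if j \in J then w else 1.
have e : diag_mx rows *m B = B' *m diag_mx cols.
  apply/matrixP => x j; rewrite mul_diag_mx mul_mx_diag !mxE.
  case: splitP => i ei; last by case: ifP => _; rewrite ?mulr1 // mulrC.
  have -> : x = lshift p i by apply: val_inj.
  by rewrite mul1r; case: ifP => [/qP->|_]; rewrite ?mulr1 // mulrC.
have wp_inj : injective ( *%R (w ^+ p)) by exact: lregX.
exists (\det B'); apply: wp_inj; rewrite /= mulrA -exprD -cJ mulrC [RHS]mulrC.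
have := congr1 determinant e; rewrite !det_mulmx !det_diag.
have -> : \prod_i rows 0 i = w ^+ p.
  rewrite big_split_ord /= big1 => [|i _]; last first.
    by rewrite mxE; case: splitP => // j /= ej; have := ltn_ord i; lia.
  rewrite mul1r (eq_bigr (fun=> w)) ?prodr_const ?card_ord // => i _.
  by rewrite mxE; case: splitP => // j /= ej; have := ltn_ord j; lia.
have -> : \prod_j cols 0 j = w ^+ #|J|.
  rewrite -prodr_const [RHS]big_mkcond; apply: eq_bigr => j _.
  by rewrite mxE.
by move=> <-; rewrite mulrC.
Qed.
End MaskedLaplace.

Lemma sum_lt_separated (I : finType) (A B : {set I}) (F : I -> nat) :
  #|A| = #|B| -> A != set0 -> (forall u v, u \in A -> v \in B -> (F u < F v)%N) ->
  (\sum_(u in A) F u < \sum_(v in B) F v)%N.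
Proof.
move=> cAB A0 AB; have A_gt0 : (0 < #|A|)%N by rewrite card_gt0.
have [u0 u0A maxE] := eq_bigmax_cond F A_gt0.
apply: (@leq_trans (#|A| * (F u0).+1)%N).
  apply: (@leq_ltn_trans (#|A| * F u0)%N); last by rewrite ltn_pmul2l.
  rewrite -sum_nat_const; apply: leq_sum => u uA.
  by rewrite -maxE; apply: leq_bigmax_cond.
by rewrite cAB -sum_nat_const; apply: leq_sum => v; apply: AB.
Qed.

Section PluckerRelation.
Variables (S : comNzRingType) (V : S -> Prop).
Hypotheses (V0 : V 0) (VB : forall x y, V x -> V y -> V (x - y)).
Variables (p N : nat) (M : 'M[{poly S}]_(p, N)) (al be : 'I_p -> 'I_N).
Variables (JL JR : {set 'I_p}) (a b r : nat).

Definition mcoef (f : 'I_p -> 'I_N) (c : nat) : S := (\det (colsub f M))`_c.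

Hypothesis JLR : forall x y, x \in JL -> y \in JR -> (be y < al x)%N.
Hypothesis cardJ : (#|JL| + #|JR| = p + r)%N.
Hypothesis abr : (b.+1 = a + r)%N.
Hypothesis V_smaller : forall f g : 'I_p -> 'I_N,
  (\sum_i f i < \sum_i al i)%N -> V (mcoef f a * mcoef g b).
Hypothesis V_outside : forall (f g : 'I_p -> 'I_N) x y,
  (x + y = a + b)%N -> (x < a)%N || (y < a)%N -> V (mcoef f x * mcoef g y).

(** The columns [al], then [be], of [M(u)] on top of [M(v)]; a column [al] outside
    [JL] is cut to the top half and a column [be] outside [JR] to the bottom
    half. *)
Let col (j : 'I_(p + p)) : 'I_N :=
  match split j with inl i => al i | inr i => be i end.
Let top (j : 'I_(p + p)) : bool :=
  match split j with inl i => true | inr i => i \in JR end.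
Let bot (j : 'I_(p + p)) : bool :=
  match split j with inl i => i \in JL | inr i => true end.
Let Mu : 'M[{poly {poly S}}]_(p, N) := map_mx polyC M.
Let Mv : 'M[{poly {poly S}}]_(p, N) := map_mx (map_poly polyC) M.
Let Bt : 'M[{poly {poly S}}]_(p, p + p) :=
  \matrix_(i, j) if top j then Mu i (col j) else 0.
Let Bb : 'M[{poly {poly S}}]_(p, p + p) :=
  \matrix_(i, j) if bot j then Mv i (col j) else 0.

Let coef_uv (f g : {poly S}) x y : (f%:P * map_poly polyC g)`_y`_x = f`_x * g`_y.
Proof. by rewrite coefCM coef_map /= coefMC. Qed.

Let diffX_dvd (f : {poly S}) : exists q, map_poly polyC f - f%:P = diffX S * q.
Proof.
have /factor_theorem[q ->] : root (map_poly polyC f - f%:P) 'X.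
  by rewrite /root hornerD hornerN hornerC -/(f \Po 'X) comp_polyXr subrr.
by exists q; rewrite mulrC.
Qed.

Let J : {set 'I_(p + p)} := [set j | top j && bot j].

Let col_l i : col (lshift p i) = al i.
Proof. by rewrite /col (unsplitK (inl i)). Qed.
Let col_r i : col (rshift p i) = be i.
Proof. by rewrite /col (unsplitK (inr i)). Qed.
Let top_l i : top (lshift p i).
Proof. by rewrite /top (unsplitK (inl i)). Qed.
Let top_r i : top (rshift p i) = (i \in JR).
Proof. by rewrite /top (unsplitK (inr i)). Qed.
Let bot_l i : bot (lshift p i) = (i \in JL).
Proof. by rewrite /bot (unsplitK (inl i)). Qed.
Let bot_r i : bot (rshift p i).
Proof. by rewrite /bot (unsplitK (inr i)). Qed.

Let card_J : #|J| = (p + r)%N.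
Proof.
rewrite -cardJ -!sum1_card [LHS]big_mkcond [X in _ = (X + _)%N]big_mkcond.
rewrite [X in _ = (_ + X)%N]big_mkcond big_split_ord /=.
by congr (_ + _)%N; apply: eq_bigr => i _; rewrite inE ?top_l ?bot_l // top_r bot_r andbT.
Qed.

Let det_divisible : exists Q, \det (col_mx Bt Bb) = diffX S ^+ r * Q.
Proof.
have -> : \det (col_mx Bt Bb) = \det (col_mx (Bb - Bt) (- Bb)).
  pose L : 'M[{poly {poly S}}]_(p + p) := block_mx (- 1%:M) 1%:M 0 (- 1%:M).
  have -> : col_mx (Bb - Bt) (- Bb) = L *m col_mx Bt Bb.
    by rewrite mul_block_col !mulNmx !mul1mx mul0mx add0r addrC.
  rewrite det_mulmx det_ublock -scaleN1r detZ det1 mulr1 -expr2 -exprM mulnC.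
  by rewrite exprM sqrrN expr1n expr1n mul1r.
apply: (@det_scaled_block _ p r _ J) => //.
  rewrite /diffX; apply: monic_lreg; exact: monicXsubC.
move=> i j; rewrite inE => /andP[tj bj]; rewrite col_mxEu !mxE tj bj.
exact: diffX_dvd.
Qed.

Let T0 : {set 'I_(p + p)} := [set lshift p x | x : 'I_p].

Let card_T0 : #|T0| = p.
Proof. by rewrite card_imset ?card_ord //; apply: lshift_inj. Qed.

Let col0_det (A : 'M[{poly {poly S}}]_p) j : (forall i, A i j = 0) -> \det A = 0.
Proof.
by move=> A0; rewrite (expand_det_col _ j) big1 // => i _; rewrite A0 mul0r.
Qed.

Let smaller_columns (T : {set 'I_(p + p)}) : #|T| = p -> T != T0 ->
  (forall j, j \in T -> top j) -> (forall j, j \in ~: T -> bot j) ->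
  (\sum_(j in T) col j < \sum_i al i)%N.
Proof.
move=> cT nT Ttop Tbot; have -> : (\sum_i al i = \sum_(j in T0) col j)%N.
  rewrite big_imset /=; last by move=> x y _ _; apply: lshift_inj.
  by apply: eq_bigr => i _; rewrite col_l.
rewrite [X in (X < _)%N](big_setID T0) [X in (_ < X)%N](big_setID T) /= setIC ltn_add2l.
have cD : #|T :\: T0| = #|T0 :\: T|.
  by apply/eqP; rewrite -(eqn_add2l #|T :&: T0|) cardsID setIC cardsID cT card_T0.
apply: sum_lt_separated => // [|u v].
  apply: contra nT => /eqP D0; rewrite eqEcard cT card_T0 leqnn andbT.
  by rewrite -setD_eq0 D0.
rewrite !inE => /andP[nu uT] /andP[nv /imsetP[x _ ve]].
rewrite ve col_l; have {nu} [y ue] : exists y, u = rshift p y.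
  case: (splitP u) => y e; last by exists y; apply: val_inj.
  by case/negP: nu; apply/imsetP; exists y => //; apply: val_inj.
rewrite ue col_r; apply: JLR; first by rewrite -bot_l -ve Tbot // inE.
by rewrite -top_r -ue Ttop.
Qed.

Let term (T : {set 'I_(p + p)}) : {poly {poly S}} :=
  \det (\matrix_(i, j) if (i \in T0) == (j \in T) then (col_mx Bt Bb) i j else 0).

Let coef_sign (e : bool) (F : {poly {poly S}}) x y :
  ((-1) ^+ e * F)`_y`_x = (-1) ^+ e * F`_y`_x.
Proof. by case: e; rewrite ?mul1r // !expr1 !mulN1r !coefN. Qed.

Let termP (T : {set 'I_(p + p)}) : #|T| = p ->
  term T = 0 \/ exists (e : bool) (f g : 'I_p -> 'I_N),
  (forall x y, (term T)`_y`_x = (-1) ^+ e * (mcoef f x * mcoef g y)) /\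
  (T != T0 -> (\sum_i f i < \sum_i al i)%N).
Proof.
move=> cT; have [e [f [g [f_inj Tf Tg]]]] := det_mask Bt Bb cT.
rewrite -/T0 -/(term T) => tE.
have [/forallP topf|/forallPn[i ni]] := boolP [forall i, top (f i)]; last first.
  left; rewrite tE (@col0_det _ i) ?mul0r ?mulr0 // => j.
  by rewrite !mxE (negbTE ni).
have [/forallP botg|/forallPn[i ni]] := boolP [forall i, bot (g i)]; last first.
  left; rewrite tE [\det (colsub g Bb)](@col0_det _ i) ?mulr0 // => j.
  by rewrite !mxE (negbTE ni).
right; exists e, (col \o f), (col \o g); split=> [x y|nT].
  rewrite tE; have -> : colsub f Bt = map_mx polyC (colsub (col \o f) M).
    by apply/matrixP => i j; rewrite !mxE topf.
  have -> : colsub g Bb = map_mx (map_poly polyC) (colsub (col \o g) M).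
    by apply/matrixP => i j; rewrite !mxE botg.
  by rewrite !det_map_mx coef_sign coef_uv.
have -> : (\sum_i (col \o f) i = \sum_(j in T) col j)%N.
  have -> : T = f @: 'I_p.
    apply/setP => j; rewrite Tf.
    by apply/codomP/imsetP => [[i ->]|[i _ ->]]; exists i.
  by rewrite big_imset //=; move=> x y _ _; apply: f_inj.
apply: smaller_columns => // j; first by rewrite Tf => /codomP[i ->].
by rewrite Tg => /codomP[i ->].
Qed.

(** Subtracting the halves shows that the determinant of the [2p]-square matrix is
    divisible by [(v - u) ^ r], so its coefficient at [(a, b)] is controlled by
    the coefficients outside the window from [a] to [b]. In its Laplace expansion
    the wanted product is the term of [T0], and every other nonzero term trades
    columns in [JL] for smaller ones in [JR]. *)
Lemma plucker_exchange : V (mcoef al a * mcoef be b).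
Proof.
have EE : \det (col_mx Bt Bb) = \sum_(T : {set 'I_(p + p)} | #|T| == p) term T.
  by rewrite (det_mask_sum T0) card_T0.
have cab x : (x <= a + b)%N -> V (\det (col_mx Bt Bb))`_(a + b - x)`_x.
  have [Q EQ] := det_divisible.
  apply: (window_coefficients V0 VB EQ (a := a)); first by lia.
  move=> {}x xab out; rewrite EE !coef_sum.
  apply: big_ind => // [|T /eqP /termP]; first exact: sub_closedD.
  case=> [->|[e [f [g [-> _]]]]]; first by rewrite !coef0.
  by apply: sub_closed_sign => //; apply: V_outside; lia.
have := cab a (leq_addr _ _); rewrite addKn EE (bigD1 T0) ?card_T0 //=.
have -> : term T0 = (\det (colsub al M))%:P * map_poly polyC (\det (colsub be M)).
  rewrite -!det_map_mx /=.
  have -> : term T0 = \det (block_mx (map_mx polyC (colsub al M)) 0 0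
                             (map_mx (map_poly polyC) (colsub be M))).
    congr (\det _); apply/matrixP => x y; rewrite -[x]splitK -[y]splitK.
    have inl0 i : lshift p i \in T0 by apply: imset_f.
    have inr0 i : rshift p i \in T0 = false.
      by apply/imsetP => -[j _] /eqP; rewrite eq_rlshift.
    case: (split x) => i; case: (split y) => j /=; rewrite [LHS]mxE ?inl0 ?inr0 /=.
    - by rewrite block_mxEul col_mxEu !mxE top_l col_l.
    - by rewrite block_mxEur [RHS]mxE.
    - by rewrite block_mxEdl [RHS]mxE.
    - by rewrite block_mxEdr col_mxEd !mxE bot_r col_r.
  by rewrite det_ublock.
set others := \sum_(T | _ && (T != T0)) term T.
rewrite !coefD coef_uv => Vsum; rewrite -[_ * _](addrK others`_b`_a).
apply: VB Vsum _; rewrite !coef_sum.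
apply: big_ind => // [|T /andP[/eqP/termP]]; first exact: sub_closedD.
case=> [-> _|[e [f [g [-> lt]]]] nT]; first by rewrite !coef0.
by apply: sub_closed_sign => //; apply/V_smaller/lt.
Qed.
End PluckerRelation.

(** * Lightest monomials *)

Section LeastWeight.
Variables (K : monomType) (R : fieldType) (wt : K -> nat).
Hypothesis wtM : forall u v, wt (mmul u v) = (wt u + wt v)%N.
Implicit Types (f g : {malg R[K]}) (u v : K).

(** A strictly lightest monomial plays the role of the leading monomial for a term
    order, and is multiplicative. *)
Definition leads f u : Prop :=
  f@_u != 0 /\ forall v, v \in msupp f -> v != u -> (wt u < wt v)%N.

Lemma leads_le f u v : leads f u -> v \in msupp f -> (wt u <= wt v)%N.
Proof. by move=> [_ lt] vf; have [->//|/(lt v vf)/ltnW] := eqVneq v u. Qed.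

Lemma leadsM f g u v : leads f u -> leads g v -> leads (f * g) (mmul u v).
Proof.
move=> fu gv; have [[fu0 fu1] [gv0 gv1]] := (fu, gv).
have uf : u \in msupp f by rewrite -mcoeff_neq0.
have vg : v \in msupp g by rewrite -mcoeff_neq0.
have strict u' v' : u' \in msupp f -> v' \in msupp g -> (u', v') != (u, v) ->
    (wt (mmul u v) < wt (mmul u' v'))%N.
  move=> u'f v'g; rewrite xpair_eqE negb_and !wtM => /orP[nu|nv].
    by rewrite -addSn leq_add ?fu1 ?(leads_le gv).
  by rewrite -addnS leq_add ?gv1 ?(leads_le fu).
split=> [|w /msuppM_le[u' [v' [u'f v'g ->]]] nw].
  rewrite mcoeffMl (bigD1_seq u) ?fset_uniq //= (bigD1_seq v) ?fset_uniq //= eqxx.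
  rewrite big_seq_cond big1 => [|v' /andP[v'g nv]]; last first.
    case: eqP => // e; have := strict u v' uf v'g.
    by rewrite xpair_eqE (negbTE nv) andbF e ltnn => /(_ isT).
  rewrite big_seq_cond big1 => [|u' /andP[u'f nu]]; last first.
    rewrite big_seq big1 // => v' v'g; case: eqP => // e.
    by have := strict u' v' u'f v'g; rewrite xpair_eqE (negbTE nu) e ltnn => /(_ isT).
  by rewrite !addr0 mulr1n mulf_neq0.
by apply: strict => //; apply: contra nw => /eqP[-> ->].
Qed.

Lemma leads1 : leads 1 mone.
Proof.
split; first by rewrite mcoeff1 eqxx oner_eq0.
by move=> v; rewrite msuppU1 in_fset1 => ->.
Qed.
End LeastWeight.

(** One term [p.+1 ^ (M - c)] outweighs [p] terms with keys larger than [c], so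
    the smallest key on which the families differ decides. *)
Lemma key_sum_lt p M (f g : 'I_p -> nat) i0 : (forall i, (g i <= M)%N) -> f i0 != g i0 ->
  (forall i, f i = g i \/ (f i0 < g i)%N) ->
  (\sum_i p.+1 ^ (M - g i) < \sum_i p.+1 ^ (M - f i))%N.
Proof.
have p_gt0 : (0 < p)%N := leq_ltn_trans (leq0n i0) (ltn_ord i0).
move=> gM ne sep; pose E := [pred i | f i == g i].
rewrite (bigID E) [X in (_ < X)%N](bigID E) /=.
rewrite (eq_bigr (fun i => p.+1 ^ (M - f i))%N) ?ltn_add2l; last by move=> i /eqP ->.
apply: (@leq_trans (p.+1 ^ (M - f i0))); last first.
  by rewrite (bigD1 i0) //= leq_addr.
have lt0 : (f i0 < M)%N.
  by case: (sep i0) => [e|lt]; [rewrite e eqxx in ne|apply: leq_trans (gM i0)].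
apply: (@leq_ltn_trans (p * p.+1 ^ (M - (f i0).+1))%N); last first.
  by rewrite -[(M - f i0)%N](subnSK lt0) expnS ltn_pmul2r ?expn_gt0.
apply: (@leq_trans (\sum_(i < p | ~~ E i) p.+1 ^ (M - (f i0).+1))%N).
  apply: leq_sum => i /negbTE ni; rewrite leq_exp2l // leq_sub2l //.
  by case: (sep i) => // e; rewrite /= e eqxx in ni.
rewrite sum_nat_const leq_mul2r; apply/orP; right.
by apply: leq_trans (max_card _) _; rewrite card_ord.
Qed.

Section Arithmetic.
Variable p : nat.
Hypothesis p_gt0 : (0 < p)%N.

(** Hermite's identity: increasing [a] replaces the first summand by one that is
    larger by one. *)
Lemma sum_floor a : (\sum_(i < p) (a + i) %/ p = a)%N.
Proof.
elim: a => [|a IH]; first by rewrite big1 // => i _; rewrite add0n divn_small.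
case: p p_gt0 IH => // p' _ IH.
have : (\sum_(i < p'.+1) (a.+1 + i) %/ p'.+1 + a %/ p'.+1 =
        \sum_(i < p'.+1) (a + i) %/ p'.+1 + (a + p'.+1) %/ p'.+1)%N.
  rewrite [in RHS]big_ord_recl big_ord_recr /= addn0 addSnnS.
  under eq_bigr do rewrite addSnnS.
  by rewrite addnC addnA.
by rewrite IH divnDr // divnn /=; lia.
Qed.

(** The least [l] with [a <= p * l + i]. *)
Definition ceil (a i : nat) : nat := ((a + p.-1 - i) %/ p)%N.

Lemma ceil_le a l (i : 'I_p) : (a <= p * l + i)%N = (ceil a i <= l)%N.
Proof.
have ip := ltn_ord i; rewrite /ceil -[RHS]ltnS ltn_divLR // mulSn mulnC.
by apply/idP/idP; lia.
Qed.

Lemma ceil_ge a (i : 'I_p) : (p * ceil a i + i < a + p)%N.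
Proof.
have := leq_trunc_div (a + p.-1 - i) p; rewrite -/(ceil a i) mulnC.
by have := ltn_ord i; lia.
Qed.

Lemma sum_ceil a : (\sum_(i < p) ceil a i = a)%N.
Proof.
rewrite -[RHS]sum_floor [RHS](reindex_inj rev_ord_inj) /=.
by apply: eq_bigr => i _; rewrite /ceil; congr (_ %/ _)%N; have := ltn_ord i; lia.
Qed.

Lemma sum_ge a (f : 'I_p -> nat) : (forall i, a <= p * f i + i)%N ->
  (a <= \sum_i f i)%N.
Proof.
by move=> fa; rewrite -{1}[a]sum_ceil; apply: leq_sum => i _; rewrite -ceil_le.
Qed.

Lemma sum_eq_ceil a (f : 'I_p -> nat) : (forall i, a <= p * f i + i)%N ->
  (\sum_i f i)%N = a -> forall i, f i = ceil a i.
Proof.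
move=> fa sf i; apply/eqP; rewrite eqn_leq -ceil_le fa andbT leqNgt.
apply/negP => lt; have : (\sum_(i < p) ceil a i < \sum_i f i)%N.
  rewrite [X in (X < _)%N](bigD1 i) //= [X in (_ < X)%N](bigD1 i) //= -addSn.
  by apply: leq_add => //; apply: leq_sum => j _; rewrite -ceil_le.
by rewrite sum_ceil sf ltnn.
Qed.

End Arithmetic.

(** * The lightest monomial of a quantum Pluecker coordinate *)

Lemma coef_signed_sum (R : nzRingType) (I : finType) (P : pred I) (e : bool)
    (g : I -> R) (N : I -> nat) c :
  ((-1) ^+ e * \sum_(i | P i) (g i)%:P * 'X^(N i))`_c =
  \sum_(i | P i) if c == N i then (-1) ^+ e * g i else 0.
Proof.
rewrite -(rmorph_sign (@polyC R)) coefCM coef_sum mulr_sumr; apply: eq_bigr => i _.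
by rewrite coefCM coefXn; case: eqP; rewrite ?mulr1 ?mulr0.
Qed.

Section QuantumMinors.
Variables (k : fieldType) (p m n q : nat).
Hypotheses (p_gt0 : (0 < p)%N) (q_le : (q <= n * p)%N).
Local Notation H := (qsymb p m q).
Local Notation X := (xindex p m n).
Local Notation S := {polyring k[X]}.
Implicit Types (x z : H) (s : {perm 'I_p}) (L : {ffun 'I_p -> 'I_n.+1}).

(** The monomial of the Leibniz expansion that takes from row [i] the coefficient
    of [t ^ L i] in column [al (s i)]. *)
Definition minor_mon (al : 'I_p -> 'I_(m + p)) s L : {cmonom X} :=
  \big[mmul/mone]_i ucm ((i, al (s i), L i) : X).

Definition row_levels L : bool := [forall i : 'I_p, (p * L i + i < p + q)%N].

Lemma minor_monE al s L i j l :
  minor_mon al s L ((i, j, l) : X) = ((al (s i) == j) && (L i == l) : nat).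
Proof.
have evM : {morph (fun u : {cmonom X} => u (i, j, l)) : u v / mmul u v >-> (u + v)%N}.
  by move=> u v; apply: cmM.
rewrite /minor_mon (big_morph _ evM (cm1 _)) (bigD1 i) //= cmU.
rewrite big1 => [|i' ni]; last by rewrite cmU !xpair_eqE (negbTE ni).
by rewrite addn0 !xpair_eqE eqxx.
Qed.

Lemma minor_mon_inj al s L s' L' : injective al ->
  minor_mon al s L = minor_mon al s' L' -> s = s' /\ L = L'.
Proof.
move=> al_inj e; have key i : (al (s' i) == al (s i)) && (L' i == L i).
  have := congr1 (fun u : {cmonom X} => u (i, al (s i), L i)) e.
  by rewrite !minor_monE !eqxx /=; case: (_ && _).
split; first by apply/permP => i; have /andP[/eqP/al_inj->] := key i.
by apply/ffunP => i; have /andP[_ /eqP->] := key i.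
Qed.

Lemma mdeg_minor_mon al s L : mdeg (minor_mon al s L) = p.
Proof.
rewrite /minor_mon mdeg_prod (eq_bigr (fun=> 1%N)) ?sum_nat_const ?card_ord ?muln1 //.
by move=> i _; rewrite mdegU.
Qed.

Lemma coef_minor (al : 'I_p -> 'I_(m + p)) c :
  (\det (colsub al (Mq k p m n q)))`_c =
  \sum_(s : {perm 'I_p}) \sum_(L | row_levels L && (\sum_i L i == c)%N)
    << (-1) ^+ s *g minor_mon al s L >>.
Proof.
rewrite coef_sum; apply: eq_bigr => s _.
have -> : \prod_i (colsub al (Mq k p m n q)) i (s i) = \sum_(L | row_levels L)
    (<< minor_mon al s L >> : S)%:P * 'X^(\sum_i L i).
  rewrite (eq_bigr (fun i : 'I_p => \sum_(l < n.+1 | (p * l + i < p + q)%N)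
      (xvar k i (al (s i)) l)%:P * 'X^l)); last by move=> i _; rewrite !mxE.
  rewrite (bigA_distr_big_dep (fun (i : 'I_p) (l : 'I_n.+1) => (p * l + i < p + q)%N)) /=.
  apply: eq_big => [L|L _]; first by apply/familyP/forallP.
  rewrite big_split /= -rmorph_prod -expr_sum; congr (_%:P * _).
  pose mon (u : {cmonom X}) : S := << u >>.
  rewrite /minor_mon -/(mon _) (big_morph mon (id1 := 1) (op1 := *%R)) //.
  by move=> u v; rewrite malgM_def fgmulUU mulr1.
rewrite coef_signed_sum [RHS]big_mkcondr; apply: eq_bigr => L _ /=.
rewrite eq_sym; case: ifP => // _.
by rewrite -(rmorph_sign (@malgC {cmonom X} k)) malgM_def fgmulUU mulr1 mul1m.
Qed.

(** The exponents of the rows are at most [ceil p q i], and these sum to [q]. *)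
Lemma row_levels_sum L : row_levels L -> (\sum_i L i <= q)%N.
Proof.
move=> /forallP ok; rewrite -[X in (_ <= X)%N](sum_ceil p_gt0) leqNgt.
apply/negP => lt; have [i lti] : exists i : 'I_p, (ceil p q i < L i)%N.
  apply/existsP; apply: contraLR lt => /existsPn le; rewrite -leqNgt.
  by apply: leq_sum => i _; rewrite leqNgt.
have : (q <= p * (L i).-1 + i)%N by rewrite ceil_le //; lia.
by have := ok i; nia.
Qed.

Lemma lead_level_subproof x (i : 'I_p) : (ceil p (qdeg x) i < n.+1)%N.
Proof.
have := ceil_ge p_gt0 (qdeg x) i; have := ltn_ord (qdeg x).
by move=> h1 h2; nia.
Qed.
Definition lead_level x : {ffun 'I_p -> 'I_n.+1} :=
  [ffun i => Ordinal (lead_level_subproof x i)].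

Definition lead_offset x (i : 'I_p) : nat := (p * ceil p (qdeg x) i + i - qdeg x)%N.

Lemma lead_offsetE x (i : 'I_p) :
  (p * lead_level x i + i = qdeg x + lead_offset x i)%N /\ (lead_offset x i < p)%N.
Proof.
rewrite ffunE /= /lead_offset; have := ceil_ge p_gt0 (qdeg x) i.
have : (qdeg x <= p * ceil p (qdeg x) i + i)%N by rewrite ceil_le.
by lia.
Qed.

Lemma lead_offset_inj x : injective (lead_offset x).
Proof.
move=> i j e; apply: val_inj => /=.
have [ei _] := lead_offsetE x i; have [ej _] := lead_offsetE x j.
have := congr1 (modn^~ p) (etrans ei (etrans (congr1 _ e) (esym ej))).
by rewrite ![(p * _)%N]mulnC !modnMDl !modn_small.
Qed.

Definition lead_col x (i : 'I_p) : 'I_p := rev_ord (Ordinal (lead_offsetE x i).2).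

Lemma lead_col_inj x : injective (lead_col x).
Proof. by move=> i j /rev_ord_inj/(congr1 val)/lead_offset_inj. Qed.

(** The numbers [p * l + i] of the chosen variables fill the window of length [p]
    starting at [qdeg x], and the columns of [x] decrease along it. *)
Definition lead x : {cmonom X} :=
  minor_mon (qcol x) (perm (@lead_col_inj x)) (lead_level x).

Definition position (i : 'I_p) (l : nat) : nat := (q + p - (p * l + i))%N.

(** The padded sequence [qext x] lists the column used at each position; a padding
    value marks a position outside the window of [x]. *)
Lemma leadE x i j l : lead x ((i, j, l) : X) = (qext x (position i l) == j.+1 :> nat).
Proof.
rewrite minor_monE permE; congr (nat_of_bool _).
have [e lt] := lead_offsetE x i; have hx := ltn_ord (qdeg x).
have [<-|nl] := eqVneq (lead_level x i) l.
  rewrite andbT /position e (@qext_in _ _ _ _ (lead_col x i)) ?eqSS //.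
  by rewrite /=; lia.
rewrite andbF; apply/esym/negbTE/eqP => E; case/eqP: nl; apply: val_inj => /=.
have := qext_cases x (position i l); rewrite E /position; have := ltn_ord j.
have := ltn_ord i; move: e lt; rewrite /position; nia.
Qed.

Definition var_key (v : X) : nat := ((m + p) * (p * v.2 + v.1.1) + v.1.2)%N.
Definition key_bound : nat := ((m + p) * (p * n.+1 + p))%N.
(** Powers of [p.+1] make this a reverse lexicographic comparison: a monomial is
    heavy when it uses a variable with a small number [p * l + i], or among
    those a small column. *)
Definition weight (u : {cmonom X}) : nat :=
  (\sum_(v : X) u v * p.+1 ^ (key_bound - var_key v))%N.

Lemma weightM u v : weight (mmul u v) = (weight u + weight v)%N.
Proof. by rewrite /weight -big_split; apply: eq_bigr => w _; rewrite cmM mulnDl. Qed.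

Lemma weight_minor_mon al s L : weight (minor_mon al s L) =
  (\sum_i p.+1 ^ (key_bound - var_key ((i, al (s i), L i) : X)))%N.
Proof.
have w1 : weight mone = 0%N by rewrite /weight big1 // => v _; rewrite cm1.
rewrite /minor_mon (big_morph _ weightM w1); apply: eq_bigr => i _.
rewrite /weight (bigD1 ((i, al (s i), L i) : X)) //= cmU eqxx mul1n big1 ?addn0 //.
by move=> v nv; rewrite cmU eq_sym (negbTE nv).
Qed.

Lemma var_key_bound v : (var_key v <= key_bound)%N.
Proof.
case: v => [[i j] l]; rewrite /var_key /key_bound /=.
have := ltn_ord i; have := ltn_ord j; have := ltn_ord l; nia.
Qed.

(** Levels summing to [qdeg x] either include one below the window of [x], which
    is heavier than the whole of [lead x], or are those of [lead x]. In the
    latter case the first position at which the columns differ carries a smaller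
    column, since [lead x] has already used the larger ones. *)
Lemma lead_lightest x s L : row_levels L -> (\sum_i L i = qdeg x)%N ->
  minor_mon (qcol x) s L != lead x ->
  (weight (lead x) < weight (minor_mon (qcol x) s L))%N.
Proof.
move=> Lok Lsum ne; rewrite !weight_minor_mon.
pose ko (i : 'I_p) := var_key ((i, qcol x (perm (@lead_col_inj x) i), lead_level x i) : X).
pose kf (i : 'I_p) := var_key ((i, qcol x (s i), L i) : X).
suff [i0 ne0 sep] : exists2 i0, kf i0 != ko i0 & forall i, kf i = ko i \/ (kf i0 < ko i)%N.
  have ko_bound i : (ko i <= key_bound)%N by apply: var_key_bound.
  exact: key_sum_lt ko_bound ne0 sep.
have koE i : ko i = ((m + p) * (qdeg x + lead_offset x i) + qcol x (lead_col x i))%N.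
  by rewrite /ko /var_key /= permE (lead_offsetE x i).1.
have [/existsP[i0 lt0]|/existsPn ge] := boolP [exists i, (p * L i + i < qdeg x)%N].
  have lt i : (kf i0 < ko i)%N.
    rewrite koE /kf /var_key /=; have := ltn_ord (qcol x (s i0)); nia.
  by exists i0; [rewrite ltn_eqF|right].
have Leq i : L i = lead_level x i.
  apply: val_inj; rewrite ffunE /=; apply: (sum_eq_ceil p_gt0 _ Lsum) => j.
  by rewrite leqNgt.
have [i1 ni1] : exists i, s i != lead_col x i.
  apply/existsP; apply: contraR ne => /existsPn e; apply/eqP.
  rewrite /lead (_ : s = perm (@lead_col_inj x)).
    by congr minor_mon; apply/ffunP.
  by apply/permP => i; rewrite permE; apply/eqP; have := e i; rewrite negbK.
have [i0 ni0 min0] :=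
  @arg_minnP _ i1 (fun i => s i != lead_col x i) (lead_offset x) ni1.
have kfE i : kf i = ((m + p) * (qdeg x + lead_offset x i) + qcol x (s i))%N.
  by rewrite /kf /var_key /= Leq (lead_offsetE x i).1.
have lt0 : (qcol x (s i0) < qcol x (lead_col x i0))%N.
  apply: qcol_lt; rewrite ltn_neqAle ni0 /= leqNgt; apply/negP => gt.
  pose i2 := invF (@lead_col_inj x) (s i0).
  have e2 : lead_col x i2 = s i0 by apply: f_invF.
  have lt2 : (lead_offset x i2 < lead_offset x i0)%N.
    by rewrite -e2 /= in gt; have := (lead_offsetE x i2).2; lia.
  have s2 : s i2 = lead_col x i2.
    by apply/eqP; apply: contraTT lt2 => /min0; rewrite -leqNgt.
  by move: lt2; rewrite (perm_inj (etrans s2 e2)) ltnn.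
exists i0; first by rewrite kfE koE eqn_add2l neq_ltn lt0.
move=> i; have [e|ni] := eqVneq (s i) (lead_col x i).
  by left; rewrite kfE koE e.
right; rewrite kfE koE; have := min0 i ni; rewrite leq_eqVlt => /orP[/eqP/lead_offset_inj<-|lt].
  by rewrite ltn_add2l.
have := ltn_ord (qcol x (s i0)); nia.
Qed.

Lemma qplucker_coef x u : (qplucker k n x)@_u =
  \sum_(s : {perm 'I_p}) \sum_(L | row_levels L && (\sum_i L i == qdeg x)%N)
    (-1) ^+ s *+ (minor_mon (qcol x) s L == u).
Proof.
rewrite /qplucker /qminor coef_minor raddf_sum; apply: eq_bigr => s _.
by rewrite raddf_sum; apply: eq_bigr => L _; exact: mcoeffU.
Qed.

Lemma qplucker_supp x u : u \in msupp (qplucker k n x) ->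
  exists s L, [/\ row_levels L, (\sum_i L i = qdeg x)%N & u = minor_mon (qcol x) s L].
Proof.
rewrite -mcoeff_neq0 qplucker_coef => nz.
have /existsP[s /existsP[L /and3P[ok /eqP sL /eqP e]]] :
    [exists s, exists L, [&& row_levels L, (\sum_i L i)%N == qdeg x
      & minor_mon (qcol x) s L == u]].
  apply: contraNT nz => /existsPn nex; apply/eqP; apply: big1 => s _.
  apply: big1 => L /andP[ok sL].
  by have /existsPn/(_ L) := nex s; rewrite ok sL /= => /negbTE ->.
by exists s, L.
Qed.

Lemma lead_levels_ok x : row_levels (lead_level x) /\ (\sum_i lead_level x i = qdeg x)%N.
Proof.
split.
  apply/forallP => i; have [-> lt] := lead_offsetE x i.
  by have := ltn_ord (qdeg x); lia.
rewrite -[RHS](sum_ceil p_gt0); apply: eq_bigr => i _.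
by rewrite ffunE.
Qed.

Lemma qplucker_coef_mon x s0 L0 : row_levels L0 -> (\sum_i L0 i = qdeg x)%N ->
  (qplucker k n x)@_(minor_mon (qcol x) s0 L0) = (-1) ^+ s0.
Proof.
move=> ok sL; have qcol_inj : injective (qcol x).
  move=> i j e; apply: val_inj; case: (ltngtP i j) => // /(@qcol_lt _ _ _ x).
    by rewrite e ltnn.
  by rewrite e ltnn.
have okL0 : row_levels L0 && (\sum_i L0 i == qdeg x)%N by rewrite ok; apply/eqP.
pose u := minor_mon (qcol x) s0 L0; rewrite -/u.
have inner : \sum_(L | row_levels L && (\sum_i L i == qdeg x)%N)
    ((-1) ^+ s0 : k) *+ (minor_mon (qcol x) s0 L == u) = (-1) ^+ s0.
  rewrite (bigD1 L0 okL0).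
  rewrite big1 => [|L /andP[_ nL]].
    by rewrite (eqxx u); apply: addr0.
  case: (minor_mon (qcol x) s0 L =P u) => // e; have [_ eL] := minor_mon_inj qcol_inj e.
  by rewrite eL eqxx in nL.
rewrite qplucker_coef; transitivity (\sum_(s | s == s0) ((-1) ^+ s : k)).
  rewrite [RHS]big_mkcond; apply: eq_bigr => s _.
  case: eqP => [->|ns]; first exact: inner.
  apply: big1 => L _; case: (minor_mon (qcol x) s L =P u) => // e.
  by have [es _] := minor_mon_inj qcol_inj e.
exact: big_pred1_eq.
Qed.

Lemma qplucker_leads x : leads weight (qplucker k n x) (lead x).
Proof.
split; last first.
  by move=> v /qplucker_supp[s [L [ok sL ->]]]; apply: lead_lightest.
have [ok sL] := lead_levels_ok x.
by rewrite (qplucker_coef_mon _ ok sL) signr_eq0.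
Qed.

Lemma qplucker_mdeg x u : u \in msupp (qplucker k n x) -> mdeg u = p.
Proof. by move=> /qplucker_supp[s [L [_ _ ->]]]; apply: mdeg_minor_mon. Qed.

Lemma minor_coef_high (al : 'I_p -> 'I_(m + p)) c : (q < c)%N ->
  (\det (colsub al (Mq k p m n q)))`_c = 0.
Proof.
move=> qc; rewrite coef_minor big1 // => s _; rewrite big1 // => L /andP[ok /eqP e].
by have := row_levels_sum ok; rewrite e leqNgt qc.
Qed.
End QuantumMinors.

(** * Independence of standard monomials, and vanishing on Schubert varieties *)

Section QuantumStraightening.
Variables (k : fieldType) (p m n q : nat).
Hypotheses (p_gt0 : (0 < p)%N) (q_le : (q <= n * p)%N).
Local Notation H := (qsymb p m q : finDistrLatticeType _).
Local Notation X := (xindex p m n).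
Local Notation S := {polyring k[X]}.
Local Notation lead := (lead p_gt0 q_le).
Local Notation pl := (@qplucker k p m n q).
Implicit Types (x z : H).

Definition word_lead (w : seq H) : {cmonom X} := \big[mmul/mone]_(c <- w) lead c.

Lemma word_leads (w : seq H) : leads (@weight p m n) (wprod pl w) (word_lead w).
Proof.
rewrite /wprod /word_lead; elim: w => [|c w IH]; first by rewrite !big_nil; apply: leads1.
by rewrite !big_cons; apply: leadsM IH; [exact: weightM|exact: qplucker_leads].
Qed.

Lemma word_leadE w i j l : word_lead w ((i, j, l) : X) =
  count (fun x => qext x (position q i l) == j.+1) w.
Proof.
have evM : {morph (fun u : {cmonom X} => u ((i, j, l) : X)) : u v / mmul u v >-> (u + v)%N}.
  by move=> u v; apply: cmM.
rewrite /word_lead (big_morph _ evM (cm1 _)) -sum1_count [RHS]big_mkcond.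
by apply: eq_bigr => c _; rewrite leadE; case: (_ == _).
Qed.

Lemma word_lead_size w : mdeg (word_lead w) = (p * size w)%N.
Proof.
rewrite /word_lead mdeg_prod (eq_bigr (fun=> p)) => [|c _]; last exact: mdeg_minor_mon.
by rewrite big_const_seq count_predT iter_addn_0 mulnC.
Qed.

Lemma position_onto t : (0 < t)%N -> (t <= q + p)%N ->
  exists (i : 'I_p) (l : 'I_n.+1), position q i l = t.
Proof.
move=> t0 tqp; have ip : ((q + p - t) %% p < p)%N by rewrite ltn_mod.
have ln : ((q + p - t) %/ p < n.+1)%N by rewrite ltn_divLR //; lia.
exists (Ordinal ip), (Ordinal ln); rewrite /position /= mulnC -divn_eq; lia.
Qed.

Lemma count_position_values (w : seq H) t :
  (\sum_(y < (m + p).+2) count (fun x => qext x t == y) w = size w)%N.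
Proof.
elim: w => [|c w IH]; first by rewrite big1.
have le : (qext c t < (m + p).+2)%N by have := qext_cases c t; lia.
have one : (\sum_(y < (m + p).+2) (qext c t == y) = 1)%N.
  rewrite (bigD1 (Ordinal le)) //= eqxx big1 // => y ny.
  by apply/eqP; rewrite eqb0 eq_sym.
by rewrite /= big_split /= IH one.
Qed.

(** The entries equal to [0] or [m + p + 1] leave no trace in the monomial; they
    are recovered from the number of letters, position after position. *)
Lemma word_lead_counts (u v : seq H) : word_lead u = word_lead v ->
  forall t y, count (fun x => qext x t == y) u = count (fun x => qext x t == y) v.
Proof.
move=> e; have size_uv : size u = size v.
  by apply/eqP; rewrite -(eqn_pmul2l p_gt0) -!word_lead_size e.
elim/ltn_ind => t IH.
have const c (w : seq H) y : (forall x, qext x t = c) ->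
    count (fun x => qext x t == y) w = (if c == y then size w else 0)%N.
  move=> tc; rewrite (eq_count (a2 := fun=> c == y)) => [|x]; last by rewrite tc.
  by case: ifP; rewrite ?count_predT ?count_pred0.
have [t0|t_gt0] := posnP t.
  have z x : qext x t = 0%N by have := qext_cases x t; have := ltn_ord (qdeg x); lia.
  by move=> y; rewrite !(const 0%N) // size_uv.
have [tqp|tqp] := leqP t (q + p)%N; last first.
  have z x : qext x t = (m + p).+1 by have := qext_cases x t; lia.
  by move=> y; rewrite !(const (m + p).+1) // size_uv.
have mid y : (0 < y)%N -> (y <= m + p)%N ->
    count (fun x => qext x t == y) u = count (fun x => qext x t == y) v.
  case: y => // y _ lt; have [i [l til]] := position_onto t_gt0 tqp.
  by have := word_leadE u i (Ordinal lt) l; rewrite e word_leadE til.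
have top : count (fun x => qext x t == (m + p).+1) u =
           count (fun x => qext x t == (m + p).+1) v.
  have [tp|tp] := leqP t p.
    have none (w : seq H) : count (fun x => qext x t == (m + p).+1) w = 0%N.
      apply/eqP; rewrite -leqn0 leqNgt -has_count; apply/hasPn => x _.
      by have := qext_cases x t; have := ltn_ord (qdeg x); lia.
    by rewrite !none.
  have back (w : seq H) : count (fun x => qext x t == (m + p).+1) w =
      (size w - count (fun x => qext x (t - p)%N == 0%N) w)%N.
    rewrite -(count_predC (fun x => qext x (t - p)%N == 0%N) w) addKn.
    apply: eq_count => x /=.
    by have := qext_cases x t; have := qext_cases x (t - p)%N; lia.
  by rewrite !back size_uv IH //; lia.
move=> y; have [y_big|] := ltnP (m + p).+1 y.
  have none (w : seq H) : count (fun x => qext x t == y) w = 0%N.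
    apply/eqP; rewrite -leqn0 leqNgt -has_count; apply/hasPn => x _.
    by have := qext_cases x t; lia.
  by rewrite !none.
rewrite leq_eqVlt => /orP[/eqP->//|ylt].
case: y ylt => [_|y ylt]; last by apply: mid.
have split_ends (w : seq H) : (count (fun x => qext x t == 0) w +
    (\sum_(i < m + p) count (fun x => qext x t == i.+1) w +
     count (fun x => qext x t == (m + p).+1) w) = size w)%N.
  by rewrite -[RHS](count_position_values w t) big_ord_recl big_ord_recr.
have rest : (\sum_(i < m + p) count (fun x => qext x t == i.+1) u =
             \sum_(i < m + p) count (fun x => qext x t == i.+1) v)%N.
  by apply: eq_bigr => i _; apply: mid.
by have := split_ends u; have := split_ends v; rewrite rest top size_uv; lia.
Qed.

(** Along a chain the entries at a given position are sorted, so their multiset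
    determines them. *)
Lemma word_lead_inj (u v : seq H) : sorted <=%O u -> sorted <=%O v ->
  word_lead u = word_lead v -> u = v.
Proof.
move=> su sv e; have cuv := word_lead_counts e.
have ext t : map (fun x => qext x t) u = map (fun x => qext x t) v.
  have sorted_ext (w : seq H) : sorted <=%O w -> sorted leq (map (fun x => qext x t) w).
    by rewrite sorted_map; apply: sub_sorted => x y /qsymb_leP/(_ t).
  apply: (sorted_eq leq_trans anti_leq); rewrite ?sorted_ext //.
  by apply/allP => y _; rewrite /= !count_map cuv.
have size_uv : size u = size v by have := congr1 size (ext 0%N); rewrite !size_map.
case: u su e {cuv} ext size_uv => [|c u] _ _ ext size_uv; first by case: v {sv ext} size_uv.
apply: (eq_from_nth (x0 := c)) => // i iu; apply: qext_inj => t.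
have := congr1 (fun s => nth (qext c t) s i) (ext t).
by rewrite !(nth_map c) -?size_uv.
Qed.

(** Among the words of [f] satisfying [Q], the one whose leading monomial is
    lightest contributes to that monomial alone. *)
Lemma lightest_word (f : {freealg k[H]}) (Q : pred {fmonom H}) w0 : standard f ->
  w0 \in msupp f -> Q w0 -> exists w, [/\ w \in msupp f, Q w &
    forall u, u \in msupp f -> Q u -> u != w -> (wprod pl u)@_(word_lead w) = 0].
Proof.
move=> sf w0f Qw0.
pose P N := has (fun u : {fmonom H} => Q u && (weight (word_lead u) == N)) (msupp f).
have exP : exists N, P N.
  by exists (weight (word_lead w0)); apply/hasP; exists w0; rewrite // Qw0 eqxx.
case: (ex_minnP exP) => N /hasP[w wf /andP[Qw /eqP wN]] minN.
exists w; split=> // u uf Qu nuw; apply/eqP; rewrite mcoeff_eq0.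
apply/negP => wu; have [_ lt] := word_leads u.
have le : (weight (word_lead w) <= weight (word_lead u))%N.
  by rewrite wN; apply: minN; apply/hasP; exists u; rewrite ?Qu ?eqxx.
have ne : word_lead w != word_lead u.
  apply: contra nuw => /eqP e; rewrite fmP; apply/eqP.
  by apply: word_lead_inj; rewrite ?sf.
by have := lt _ wu ne; rewrite ltnNge le.
Qed.

Lemma standard_independent (f : {freealg k[H]}) : standard f ->
  free_eval pl f = 0 -> f = 0.
Proof.
move=> sf f0; apply/malgP => w0; rewrite mcoeff0; apply/eqP; apply: contraT.
rewrite mcoeff_neq0 => w0f.
have [w [wf _ other]] := lightest_word (Q := predT) sf w0f isT.
have := congr1 (mcoeff (word_lead w)) f0.
rewrite free_evalE raddf_sum mcoeff0 (bigD1_seq w) ?fset_uniq //=.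
rewrite big_seq_cond big1 => [|u /andP[uf nu]]; last by rewrite mcoeffZ other ?mulr0.
move/eqP; rewrite addr0 mcoeffZ mulf_eq0 mcoeff_eq0 wf /=.
by rewrite (negbTE (word_leads w).1).
Qed.

(** The monomials that survive when the variables not above [z] are set to zero;
    this is the specialisation to the Schubert variety of [z]. *)
Definition allowed z (u : {cmonom X}) : Prop := forall i j l,
  (0 < u ((i, j, l) : X))%N -> (qext z (position q i l) <= j.+1)%N.

Lemma allowedM z u v : allowed z (mmul u v) <-> allowed z u /\ allowed z v.
Proof.
split=> [uv|[zu zv] i j l]; last by rewrite cmM addn_gt0 => /orP[/zu|/zv].
by split=> i j l lt; apply: uv; rewrite cmM addn_gt0 lt ?orbT.
Qed.

Lemma allowed_word z (w : seq H) : all (fun x => (z <= x)%O) w ->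
  allowed z (word_lead w).
Proof.
move=> zw i j l; rewrite word_leadE -has_count => /hasP[x xw /eqP <-].
exact: (qsymb_leP _ _ (allP zw x xw)).
Qed.

(** If every variable of a monomial of [pl x] were allowed for [z], then the rows
    whose column lies before a violation of [z <= x] would sit at higher powers
    of [t] than their total degree permits. *)
Lemma qplucker_vanishes z x u : ~~ (z <= x)%O -> u \in msupp (pl x) ->
  ~ allowed z u.
Proof.
move=> nzx /qplucker_supp[s [L [ok sL ->]]] alw; case/negP: nzx.
have zL i : (qext z (position q i (L i)) <= (qcol x (s i)).+1)%N.
  by apply: alw; rewrite minor_monE !eqxx.
have mono t t' : (t <= t')%N -> (qext z t <= qext z t')%N.
  move=> tt'; have := qext_cases z t; have := qext_cases z t'.
  have hz := ltn_ord (qdeg z); elim: t' tt' => [|t' IH].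
    by rewrite leqn0 => /eqP ->.
  rewrite leq_eqVlt => /orP[/eqP->//|]; rewrite ltnS => /IH {}IH.
  have := qext_lt z t'; have := qext_cases z t'; lia.
apply/qsymb_leP => T; rewrite leqNgt; apply/negP => lt.
have hx := ltn_ord (qdeg x); have hz := ltn_ord (qdeg z).
have zT : (q < T + qdeg z)%N by have := qext_cases z T; lia.
have Tx : (T + qdeg x <= q + p)%N.
  by have := qext_cases x T; have := qext_cases z T; lia.
have low i : (q < p * (L i) + i + T)%N.
  have := zL i; have := qext_cases z (position q i (L i)); rewrite /position.
  have := ltn_ord (qcol x (s i)); have /forallP/(_ i) := ok; lia.
have [Tout|Tin] := leqP (T + qdeg x) q.
  have := sum_ge p_gt0 (a := (q.+1 - T)%N) (f := fun i => L i).
  rewrite sL => h; have : (q.+1 - T <= qdeg x)%N by apply: h => i; have := low i; lia.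
  by lia.
have cp : (T + qdeg x - q.+1 < p)%N by lia.
pose c := Ordinal cp.
have xT : qext x T = (qcol x c).+1 by apply: qext_in => /=; lia.
pose before i := (s i <= c)%N.
have high i : before i -> (q + p < p * (L i) + i + T)%N.
  move=> sic; have le : (qcol x (s i) <= qcol x c)%N.
    by move: sic; rewrite /before leq_eqVlt => /orP[/eqP/val_inj->//|/qcol_lt/ltnW].
  rewrite ltnNge; apply/negP => ge.
  have : (qext z T <= qext z (position q i (L i)))%N by apply: mono; rewrite /position; lia.
  by have := zL i; rewrite xT in lt; lia.
have card_before : (\sum_i before i = c.+1)%N.
  rewrite (reindex_inj (@perm_inj _ s^-1%g)) /=.
  rewrite (eq_bigr (fun i : 'I_p => if (i < c.+1)%N then 1 else 0)%N); last first.
    by move=> i _; rewrite /before permKV ltnS; case: leqP.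
  by rewrite -big_mkcond -(big_ord_widen p (fun=> 1%N)) // sum_nat_const card_ord muln1.
have sum_f : (\sum_i ((L i).+1 - before i) + c.+1 = qdeg x + p)%N.
  rewrite -card_before -big_split /= -sL.
  rewrite (eq_bigr (fun i => L i + 1)%N) => [|i _]; last by case: (before i); lia.
  by rewrite big_split /= sum_nat_const card_ord muln1.
(* The bound [q.+1 - T] on the numbers of the variables can be negative, so all
   levels are raised by one. *)
have := sum_ge p_gt0 (a := (q.+1 + p - T)%N) (f := fun i => ((L i).+1 - before i)%N).
move=> h; have : (q.+1 + p - T <= \sum_i ((L i).+1 - before i))%N.
  apply: h => i; have := low i; have := @high i.
  by case: (before i) => [/(_ isT)|_]; rewrite ?subn1 ?subn0 /= ?mulnS; lia.
by move=> le; have := leq_add le (leqnn c.+1); rewrite sum_f /=; lia.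
Qed.
End QuantumStraightening.

(** * Straightening quantum Pluecker coordinates *)

Lemma signed_product (R : comNzRingType) (e e' : bool) (a b : R) :
  ((-1) ^+ e * a) * ((-1) ^+ e' * b) = (-1) ^+ (e (+) e') * (a * b).
Proof. by rewrite mulrACA signr_addb. Qed.

Lemma card_ord_lt p c : (c <= p)%N -> #|[set i : 'I_p | (i < c)%N]| = c.
Proof.
move=> cp; rewrite -sum1_card (eq_bigl (fun i : 'I_p => (i < c)%N)) => [|i]; last first.
  by rewrite inE.
by rewrite -(big_ord_widen p (fun=> 1%N)) // sum_nat_const card_ord muln1.
Qed.

Section QuantumPlucker.
Variables (k : fieldType) (p m n q : nat).
Hypotheses (p_gt0 : (0 < p)%N) (q_le : (q <= n * p)%N).
Local Notation H := (qsymb p m q : finDistrLatticeType _).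
Local Notation X := (xindex p m n).
Local Notation S := {polyring k[X]}.
Local Notation pl := (@qplucker k p m n q).
Local Notation M := (Mq k p m n q).
Implicit Types (x y z : H).

Lemma sorting_perm (N : nat) (f : 'I_p -> 'I_N) : injective f ->
  exists (s : {perm 'I_p}) (al : incseq p N), forall i, val al i = f (s i).
Proof.
move=> f_inj; pose t := [tuple f i | i < p]; pose le (u v : 'I_N) := (u <= v)%N.
have perm_st : perm_eq (sort_tuple le t) t by rewrite perm_sort.
have /tuple_permP[s sE] := perm_st.
have nthE (i : 'I_p) (x0 : 'I_N) : nth x0 (sort le t) i = f (s i).
  by rewrite sE -tnth_nth tnth_mktuple /t tnth_mktuple.
pose al := [ffun i => f (s i)].
have alP : increasing al.
  apply/forallP => i; apply/forallP => j; apply/implyP => ij; rewrite !ffunE.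
  have sle : sorted le (sort le t) by apply: sort_sorted => u v; apply: leq_total.
  have le_trans' : transitive le by move=> u v w; apply: leq_trans.
  have := sorted_ltn_nth le_trans' (f i) sle.
  move=> /(_ i j); rewrite !inE size_sort size_tuple !ltn_ord => /(_ isT isT ij).
  rewrite !nthE /le leq_eqVlt => /orP[/eqP/val_inj/f_inj/perm_inj e|//].
  by rewrite e ltnn in ij.
by exists s, (Sub al alP) => i; rewrite SubK ffunE.
Qed.

Lemma mcoef_qplucker (f : 'I_p -> 'I_(m + p)) c : mcoef M f c = 0 \/
  exists (e : bool) (x : qsymb p m q), [/\ mcoef M f c = (-1) ^+ e * pl x,
    qdeg x = c :> nat & (\sum_i qcol x i = \sum_i f i)%N].
Proof.
have [cq|qc] := leqP c q; last by left; apply: minor_coef_high.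
have [/injectiveP f_inj|/injectivePn[i [j ij e]]] := boolP (injectiveb f); last first.
  left; rewrite /mcoef -det_tr (determinant_alternate ij) ?coef0 // => r.
  by rewrite !mxE e.
have [s [al alE]] := sorting_perm f_inj; right.
exists (s : bool), (QSymb al (Ordinal (cq : c < q.+1)%N)); split=> //; last first.
  rewrite [RHS](reindex_inj (@perm_inj _ s)) /=.
  by apply: eq_bigr => i _; rewrite /qcol /= alE.
have -> : pl (QSymb al (Ordinal (cq : c < q.+1)%N)) = (\det (colsub (val al) M))`_c by [].
have -> : colsub (val al) M = colsub f M *m perm_mx s^-1%g.
  rewrite -col_permE; apply/matrixP => i j.
  by rewrite [LHS]mxE [RHS]mxE [RHS]mxE alE.
rewrite det_mulmx det_perm odd_permV [\det _ * _]mulrC /mcoef.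
by rewrite -(rmorph_sign (@polyC S)) coefCM signrMK.
Qed.

Definition colsum x : nat := (\sum_i qcol x i)%N.
Definition prank x : nat := (qdeg x * (p * (m + p)).+1 + colsum x)%N.

Lemma colsum_bound x : (colsum x < (p * (m + p)).+1)%N.
Proof.
rewrite ltnS -[p in (p * _)%N]card_ord -sum_nat_const; apply: leq_sum => i _.
exact: ltnW.
Qed.

Lemma prank_qdeg x y : (prank x <= prank y)%N -> (qdeg x <= qdeg y)%N.
Proof.
rewrite /prank => le; rewrite leqNgt; apply/negP => lt.
have := colsum_bound y; have := leq_mul lt (leqnn (p * (m + p)).+1); rewrite mulSn; lia.
Qed.

Lemma prank_ltl x y : (qdeg x < qdeg y)%N -> (prank x < prank y)%N.
Proof.
move=> lt; have := colsum_bound x; have := leq_mul lt (leqnn (p * (m + p)).+1).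
by rewrite /prank mulSn; lia.
Qed.

Lemma prank_ltr x y : qdeg x = qdeg y -> (colsum x < colsum y)%N -> (prank x < prank y)%N.
Proof. by rewrite /prank => -> ; rewrite ltn_add2l. Qed.

Definition standard_pair (w : {fmonom H}) : Prop :=
  exists z z', w = [:: z; z'] :> seq H /\ (z <= z')%O.

(** If [x] is not below [y] and has the smaller rank, then a column [i] of [x]
    exceeds the column [qdeg y - qdeg x + i] of [y]. The exchange of the columns
    of [x] from [i] on with those of [y] up to there has a window of exactly the
    length [qdeg y - qdeg x + 1], and each of the resulting products has a factor
    of degree less than [x], or of the same degree with smaller columns. *)
Lemma plucker_spanned x y : spanned pl standard_pair (pl x * pl y).
Proof.
have [N] := ubnP (minn (prank x) (prank y)); elim: N x y => // N IH x y.
have std u v : (u <= v)%O -> spanned pl standard_pair (pl u * pl v).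
  move=> uv; have -> : pl u * pl v = wprod pl (FMonom [:: u; v]).
    by rewrite /wprod !big_cons big_nil mulr1.
  by apply: spanned_word; exists u, v.
wlog xy : x y / (prank x <= prank y)%N.
  move=> wl; case/orP: (leq_total (prank x) (prank y)) => [xy|yx]; first exact: (wl x y xy).
  by rewrite minnC mulrC; exact: (wl y x yx).
rewrite (minn_idPl xy) ltnS => leN.
have [/std//|nxy] := boolP (x <= y)%O.
have ab := prank_qdeg xy.
have [i [j [ji lt]]] : exists i j : 'I_p, (j = qdeg y - qdeg x + i :> nat)%N /\
    (qcol y j < qcol x i)%N.
  move: nxy; rewrite -[(x <= y)%O]/(qsymb_le x y) /qsymb_le ab /=.
  move=> /forallPn[i /forallPn[j]]; rewrite negb_imply -ltnNge => /andP[/eqP e lt].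
  by exists i, j.
pose V := spanned pl standard_pair.
have V0 : V 0 by apply: spanned0.
have VB a b : V a -> V b -> V (a - b).
  by move=> Va Vb; apply: spannedD => //; apply: spannedN.
have small (f g : 'I_p -> 'I_(m + p)) a b :
    (forall u : H, qdeg u = a :> nat -> (\sum_i qcol u i = \sum_i f i)%N ->
       (prank u < prank x)%N) \/
    (forall u : H, qdeg u = b :> nat -> (prank u < prank x)%N) ->
    V (mcoef M f a * mcoef M g b).
  move=> lts; case: (mcoef_qplucker f a) => [->|[e [u [-> ua uf]]]]; first by rewrite mul0r.
  case: (mcoef_qplucker g b) => [->|[e' [v [-> vb _]]]]; first by rewrite mulr0.
  have Vuv : V (pl u * pl v).
    apply: IH; rewrite gtn_min; apply/orP.
    by case: lts => [/(_ u ua uf)|/(_ v vb)] lt'; [left|right]; apply: leq_trans leN.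
  by rewrite (signed_product e e' (pl u) (pl v)); apply: (sub_closed_sign V0 VB).
have plE z : pl z = mcoef M (qcol z) (qdeg z) by [].
rewrite !plE.
pose JL : {set 'I_p} := [set i' : 'I_p | (i <= i')%N].
pose JR : {set 'I_p} := [set j' : 'I_p | (j' < j.+1)%N].
apply: (@plucker_exchange _ V V0 VB p (m + p) M (qcol x) (qcol y) JL JR
  (qdeg x) (qdeg y) (qdeg y - qdeg x).+1).
- move=> i' j'; rewrite !inE => ii' jj'.
  have mono (w : H) (c c' : 'I_p) : (c <= c')%N -> (qcol w c <= qcol w c')%N.
    by rewrite leq_eqVlt => /orP[/eqP/val_inj->//|/qcol_lt/ltnW].
  by apply: leq_ltn_trans (mono y _ _ jj') (leq_trans lt (mono x _ _ ii')).
- have cL : #|JL| = (p - i)%N.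
    have -> : JL = ~: [set i' : 'I_p | (i' < i)%N].
      by apply/setP => i'; rewrite !inE -leqNgt.
    by rewrite cardsCs setCK card_ord card_ord_lt // ltnW.
  have -> : #|JR| = j.+1 by apply: card_ord_lt.
  by rewrite cL ji; have := ltn_ord i; lia.
- by lia.
- move=> f g lts; apply: small; left=> u ua uf; apply: prank_ltr; first exact: val_inj.
  by rewrite /colsum uf.
move=> f g a b e /orP[la|lb]; apply: small.
  by left=> u ua _; apply: prank_ltl; rewrite ua.
by right=> u ub; apply: prank_ltl; rewrite ub.
Qed.

(** Suppose a word occurs whose first letter [z] is not below [x]. Setting to zero
    the variables that are not allowed for [z] kills the product and all the
    words with a letter not above [z], but not the lightest monomial among the
    remaining words. *)
Theorem qplucker_straightens : straightens pl.
Proof.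
move=> x y inc; have [f fP fE] := plucker_spanned x y.
have sf : standard f.
  by move=> w /fP[z [z' [-> zz']]] /=; rewrite zz'.
have below w : w \in msupp f -> forall z z', w = [:: z; z'] :> seq H ->
    (z <= x)%O && (z <= y)%O.
  move=> wf z z' wE; apply: contraT; rewrite negb_and => nz.
  pose Q (u : {fmonom H}) := all (fun c => (z <= c)%O) u.
  have Qw : Q w by have := sf w wf; rewrite /Q wE /= lexx andbT => ->.
  have [v [vf Qv other]] := lightest_word p_gt0 q_le sf wf Qw.
  have v_ok : allowed z (word_lead p_gt0 q_le v) by apply: allowed_word.
  have out (a b : S) c : ~~ (z <= c)%O -> (pl c * a)@_(word_lead p_gt0 q_le v) = 0.
    move=> nc; apply/eqP; rewrite mcoeff_eq0; apply/negP => /msuppM_le[u1 [u2 [u1c _ e]]].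
    by move: v_ok; rewrite e => /allowedM[/(qplucker_vanishes p_gt0 q_le nc u1c)].
  have : (pl x * pl y)@_(word_lead p_gt0 q_le v) = 0.
    by case/orP: nz => nz; [exact: (out _ 0)|rewrite mulrC; exact: (out _ 0)].
  rewrite -fE free_evalE raddf_sum (bigD1_seq v) ?fset_uniq //=.
  rewrite big_seq_cond big1 => [|u /andP[uf nu]].
    move/eqP; rewrite addr0 mcoeffZ mulf_eq0 mcoeff_eq0 vf /=.
    by rewrite (negbTE (word_leads k p_gt0 q_le v).1).
  rewrite mcoeffZ; have [Qu|nQu] := boolP (Q u); first by rewrite other ?mulr0.
  have [c [c' [uE cc']]] := fP u uf.
  have nzc : ~~ (z <= c)%O.
    apply: contra nQu => zc; rewrite /Q uE /= zc (le_trans zc cc') //.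
  by rewrite uE /wprod !big_cons (out _ 0) ?mulr0.
exists f => // w wf; have [z [z' [wE zz']]] := fP w wf.
have /andP[zx zy] := below w wf z z' wE.
exists z, z'; split=> //; rewrite lt_neqAle ?zx ?zy andbT.
  by apply: contraTneq zy => ->; apply: contra inc => xy; rewrite /Order.comparable xy.
by apply: contraTneq zx => ->; apply: contra inc => yx; rewrite /Order.comparable yx orbT.
Qed.
End QuantumPlucker.

(** * The coordinate ring of the quantum Grassmannian *)

Section KernelImage.
Variables (k : fieldType) (S T : comAlgType k) (f : {lrmorphism S -> T}).

Definition kernel_image (x : kerquot f) : T := f (repr x).

Lemma kernel_imageE y : kernel_image (kerpi f y) = f y.
Proof. by apply/eqP; rewrite /kernel_image -kerpi_eq kerpiK. Qed.

Lemma kernel_image_inj : injective kernel_image.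
Proof. by move=> x y /eqP; rewrite /kernel_image -kerpi_eq !kerpiK => /eqP. Qed.

Lemma kernel_image_zmod_morphism : zmod_morphism kernel_image.
Proof. by move=> x y; rewrite -[x]kerpiK -[y]kerpiK -rmorphB !kernel_imageE rmorphB. Qed.

Lemma kernel_image_monoid_morphism : monoid_morphism kernel_image.
Proof.
split=> [|x y]; first by rewrite -(rmorph1 (kerpi f)) kernel_imageE rmorph1.
by rewrite -[x]kerpiK -[y]kerpiK -rmorphM !kernel_imageE rmorphM.
Qed.

Lemma kernel_image_scalable : scalable kernel_image.
Proof. by move=> a x; rewrite -[x]kerpiK -linearZ !kernel_imageE linearZ. Qed.

HB.instance Definition _ := GRing.isZmodMorphism.Build (kerquot f) T
  kernel_image kernel_image_zmod_morphism.
HB.instance Definition _ := GRing.isMonoidMorphism.Build (kerquot f) T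
  kernel_image kernel_image_monoid_morphism.
HB.instance Definition _ := GRing.isScalable.Build k (kerquot f) T *:%R
  kernel_image kernel_image_scalable.
End KernelImage.

Section QuantumRing.
Variables (k : fieldType) (p m n q : nat).
Hypotheses (p_gt0 : (0 < p)%N) (q_le : (q <= n * p)%N).
Local Notation H := (qsymb p m q : finDistrLatticeType _).
Local Notation X := (xindex p m n).
Local Notation S := {polyring k[X]}.
Local Notation A := (qring k p m n q).
Local Notation pl := (@qplucker k p m n q).
Local Notation gen := (qgen k p m n q).
Local Notation gr := (qgrading k p m n q).
Local Notation proj := (qproj k p m n q).
Local Notation phi := (qphi k p m n q).

Definition qembed : A -> S := @kernel_image _ _ _ phi.
HB.instance Definition _ := GRing.LRMorphism.on qembed.

Lemma qembedE f : qembed (proj f) = phi f.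
Proof. exact: kernel_imageE. Qed.

Lemma qembed_inj : injective qembed.
Proof. exact: kernel_image_inj. Qed.

Lemma cmonom_eval_ucm (I : choiceType) (T : comAlgType k) (v : I -> T) i :
  cmonom_eval v (ucm i) = v i.
Proof. by rewrite /cmonom_eval mdomU big_seq_fset1 cmUU expr1. Qed.

Lemma qphi_monomial c w : phi << c *g w >> = c *: cmonom_eval pl w.
Proof. by rewrite /qphi /poly_eval mmapU /= mulr_algl. Qed.

Lemma qembed_gen x : qembed (gen x) = pl x.
Proof. by rewrite qembedE qphi_monomial scale1r cmonom_eval_ucm. Qed.

Lemma qembed_word (w : seq H) : qembed (wprod gen w) = wprod pl w.
Proof. by rewrite /wprod rmorph_prod; apply: eq_bigr => x _; apply: qembed_gen. Qed.

Lemma qembed_eval (f : {freealg k[H]}) : qembed (free_eval gen f) = free_eval pl f.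
Proof.
rewrite !free_evalE linear_sum; apply: eq_bigr => w _.
by rewrite linearZ /= qembed_word.
Qed.


Lemma qproj_surj (x : A) : exists f, proj f = x.
Proof. by exists (repr x); apply: kerpiK. Qed.

Lemma qring_spanned (x : A) : spanned gen (fun=> True) x.
Proof.
have [f <-] := qproj_surj x; rewrite (monalgE f) raddf_sum.
apply: spanned_sum => w _ _ /=.
have -> : proj << f@_w *g w >> = f@_w *: wprod gen (FMonom
    (flatten [seq nseq (w i) i | i <- finsupp w])).
  apply: qembed_inj; rewrite linearZ /= qembed_word qembedE qphi_monomial.
  congr (_ *: _); rewrite /cmonom_eval /wprod big_flatten big_map.
  by apply: eq_bigr => i _; rewrite big_nseq -Monoid.iteropE.
by apply/spannedZ/spanned_word.
Qed.

Definition homogeneous (N : nat) (g : S) : Prop := forall u, u \in msupp g -> mdeg u = N.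

Lemma homogeneousM N N' f g : homogeneous N f -> homogeneous N' g ->
  homogeneous (N + N') (f * g).
Proof. by move=> fN gN w /msuppM_le[u [v [/fN uN /gN vN ->]]]; rewrite mdegM uN vN. Qed.

Lemma homogeneous1 : homogeneous 0 1.
Proof. by move=> u; rewrite msuppU1 in_fset1 => /eqP ->; apply: mdeg1. Qed.

Lemma homogeneous_eval w : homogeneous (p * mdeg w) (cmonom_eval pl w).
Proof.
rewrite /cmonom_eval mdegE big_distrr /=.
apply: (big_ind2 homogeneous) => [|N f N' g|x _].
- exact: homogeneous1.
- exact: homogeneousM.
elim: (w x) => [|c IH]; first by rewrite muln0 expr0; apply: homogeneous1.
rewrite mulnS exprS; apply: homogeneousM IH; exact: qplucker_mdeg.
Qed.

Lemma homogeneous_phi d f : (forall w, w \in msupp f -> mdeg w = d) ->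
  homogeneous (p * d) (phi f).
Proof.
move=> fd u; rewrite (monalgE f) raddf_sum -mcoeff_neq0 raddf_sum /= => nz.
have /hasP[w wf /= wu] : has (fun w => u \in msupp (phi << f@_w *g w >>)) (msupp f).
  apply: contraNT nz => /hasPn no; rewrite big_seq big1 // => w /no /=.
  by rewrite -mcoeff_eq0 => /eqP.
move: wu; rewrite qphi_monomial => /(fsubsetP (msuppZ_le _ _))/homogeneous_eval.
by rewrite (fd w).
Qed.

(** The homomorphism [phi] multiplies degrees by [p], which is positive, so its
    values in different degrees cannot cancel. *)
Lemma qgrading_graded : graded_algebra gr.
Proof.
split.
- move=> x; split=> [[f f0 <-]|[c ->]].
    exists (f@_mone); have fE : f = (f@_mone)%:MP.
      apply/malgP => w; rewrite mcoeffC; case: eqP => [->|nw]; rewrite ?mulr1n ?mulr0n //.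
      by apply: mcoeff_outdom; apply/negP => /f0 /mdeg_eq0I.
    by rewrite {1}fE -[_%:MP]mulr1 mul_malgC linearZ rmorph1.
  exists c%:MP; last by rewrite -[_%:MP]mulr1 mul_malgC linearZ rmorph1.
  by move=> w /(fsubsetP (msuppC_le _)); rewrite in_fset1 => /eqP ->; apply: mdeg1.
- by move=> d; exists 0; rewrite ?raddf0 // => w; rewrite msupp0.
- move=> d c x y [f fd <-] [g gd <-]; exists (c *: f + g); last by rewrite linearP.
  move=> w /(fsubsetP (msuppD_le _ _)); rewrite in_fsetU => /orP[|/gd//].
  by move=> /(fsubsetP (msuppZ_le _ _))/fd.
- move=> d e x y [f fd <-] [g ge <-]; exists (f * g); last by rewrite rmorphM.
  by move=> w /msuppM_le[u [v [/fd ud /ge ve ->]]]; rewrite mdegM ud ve.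
- move=> x; have [f <-] := qproj_surj x; have [N fN] := msupp_degree_bound (@mdeg _) f.
  exists N, (fun e => proj (mpart (fun w => mdeg w == e) f)); split=> [e|].
    by exists (mpart (fun w => mdeg w == e) f) => // w; rewrite mem_mpart => /andP[/eqP].
  by rewrite {1}(mpart_sum fN) raddf_sum.
move=> N f gf sum0 d dN.
apply: qembed_inj; rewrite raddf0; apply/malgP => u; rewrite mcoeff0.
have hom e : homogeneous (p * e) (qembed (f e)).
  by have [g ge <-] := gf e; rewrite qembedE; apply: homogeneous_phi.
have [ud|nud] := eqVneq (mdeg u) (p * d)%N; last first.
  by apply: mcoeff_outdom; apply: contra nud => /hom ->.
have sumE : \sum_(e < N) qembed (f e) = 0 by rewrite -raddf_sum sum0 raddf0.
have sum_u : \sum_(e < N) (qembed (f e))@_u = 0 by rewrite -(raddf_sum (mcoeff u)) sumE raddf0.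
rewrite -[RHS]sum_u (bigD1 (Ordinal dN)) // big1; first by rewrite [RHS]addr0.
move=> e ne.
apply: mcoeff_outdom; apply/negP => /hom /eqP; rewrite ud eqn_pmul2l // eq_sym => /eqP ed.
by case/eqP: ne; apply: val_inj.
Qed.

Lemma qgen_straightens : straightens (H := H) gen.
Proof.
move=> c e inc; have [f fP fE] := @qplucker_straightens k p m n q p_gt0 q_le c e inc.
exists f => //; apply: qembed_inj; rewrite qembed_eval fE -!qembed_gen; exact/esym/rmorphM.
Qed.

Lemma standard_independent_qring (f : {freealg k[H]}) : standard (H := H) f ->
  free_eval gen f = 0 -> f = 0.
Proof.
move=> sf f0; apply: (standard_independent p_gt0 q_le sf).
exact: etrans (esym (qembed_eval f)) (etrans (congr1 qembed f0) (raddf0 _)).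
Qed.

Lemma qgen_deg1 c : gr 1%N (gen c).
Proof.
by exists << ucm c >> => // w; rewrite msuppU1 in_fset1 => /eqP ->; apply: mdegU.
Qed.

Theorem quantum_asl : algebra_with_straightening_law gr (H := H) gen.
Proof.
exact: (straightening_asl qgrading_graded qgen_deg1 qring_spanned qgen_straightens
  standard_independent_qring).
Qed.
End QuantumRing.

Theorem corollary15 (k : fieldType) (p m n q : nat)
    (p_gt0 : (0 < p)%N) (m_gt0 : (0 < m)%N) (q_le : (q <= n * p)%N) :
  [/\ exists psi : {lrmorphism qring k p m n q -> {polyring k[xindex p m n]}},
        injective psi /\ forall f, psi (qproj k p m n q f) = qphi k p m n q f,
      algebra_with_straightening_law (qgrading k p m n q)
        (H := (qsymb p m q : finDistrLatticeType _)) (qgen k p m n q),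
      quadratic_groebner_presentation (qgen k p m n q)
    & koszul (qgrading k p m n q)].
Proof.
have asl := quantum_asl k m p_gt0 q_le; split=> //.
- exists (@qembed k p m n q); split; [exact: qembed_inj|exact: qembedE].
- exact: (asl_groebner asl).
- exact: (asl_koszul asl).
Qed.
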